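(* Let $m\ge5$ and $l\ge2$ be integers and let $G=C_{lm}(S)$ with $S=\{s\in\{1,\dots,\lfloor lm/2\rfloor\}: s=l\text{ or } l\nmid s\}$ (equivalently, the join of $l$ copies of $C_m$). Then $\mathrm{reg}(R/I(G))=\lfloor (m+1)/3\rfloor$, and for every integer $r$ with $2\le r<\lfloor (m+1)/3\rfloor$ and every $i$, $$\beta_{i,i+r}(G)=\frac{lm}{m-2r}\binom{m-2r}{r}\binom{(l-1)m+r}{i-r}.$$
   Context: The circulant graph $C_n(S)$ ($S\subseteq\{1,\dots,\lfloor n/2\rfloor\}$) has vertex set $\{0,\dots,n-1\}$ with $\{a,b\}$ an edge iff $\min(|a-b|,n-|a-b|)\in S$. For a graph $G$ on vertex set $V$, $R=\mathbb{K}[x_v:v\in V]$ over a fixed field $\mathbb{K}$, $I(G)=\langle x_ux_v:\{u,v\}\in E(G)\rangle$, $\beta_{i,d}(G)=\beta_{i,d}(R/I(G))$ is the graded Betti number, and $\mathrm{reg}(R/I(G))=\max\{d-i:\beta_{i,d}(G)\ne0\}$. Binomial coefficients $\binom{a}{b}$ are $0$ if $b<0$ or $b>a$. *)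

(* Defs.v *)
From mathcomp Require Import all_boot all_algebra.

Import GRing.Theory.

Definition circ_dist (n : nat) (a b : 'I_n) : nat :=
  let d := if (a <= b)%N then (b - a)%N else (a - b)%N in minn d (n - d).

Definition circulant_adj (n : nat) (S : pred nat) : rel 'I_n :=
  fun a b => [&& (1 <= circ_dist n a b)%N, (circ_dist n a b <= n./2)%N & S (circ_dist n a b)].

Definition join_S (l m : nat) : pred nat :=
  fun s => [&& (1 <= s)%N, (s <= (l * m)./2)%N & (s == l) || ~~ (l %| s)].

(* ---------- Graded Betti numbers of R/I(G) ----------
   beta_{i,d}(R/I) = dim_K Tor_i^R(R/I, K)_d, computed (by balancing of Tor)
   as the homology of the Koszul complex K(x_1,...,x_n) (x) R/I in internal
   degree d.  A K-basis of the degree-d part of K_i(x) (x) R/I is given by the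
   pairs (F, u) with F a set of variables, |F| = i, and u a standard monomial
   (monomial not in I(G)) of degree d - i.  Monomials of degree <= d are encoded
   by exponent vectors with entries in 'I_(d+1). *)

Definition expo (n d : nat) := {ffun 'I_n -> 'I_d.+1}.

Definition mdeg (n d : nat) (e : expo n d) : nat := (\sum_(k < n) (e k : nat))%N.

(* the monomial x^e is not in I(G) *)
Definition standard (n d : nat) (E : rel 'I_n) (e : expo n d) : bool :=
  [forall u, forall v, E u v ==> (((e u : nat) == 0%N) || ((e v : nat) == 0%N))].

Definition kindex (n d : nat) := ({set 'I_n} * expo n d)%type.

Definition kbasis (n : nat) (E : rel 'I_n) (d i : nat) (p : kindex n d) : bool :=
  [&& #|p.1| == i, (i <= d)%N, mdeg n d p.2 == (d - i)%N & standard n d E p.2].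

(* Koszul differential  u e_F |-> sum_{j in F} (-1)^{#{k in F, k<j}} (x_j u) e_{F\j},
   where x_j u is taken modulo I(G) (zero when it lies in I(G)).  Entry (p,q) is
   the coefficient of q in the image of p (row-vector convention). *)
Definition kentry (K : fieldType) (n : nat) (E : rel 'I_n) (d i : nat)
    (p q : kindex n d) : K :=
  match [pick j in p.1 | (q.1 == p.1 :\ j) &&
                          [forall k, (q.2 k : nat) == (p.2 k + (k == j))%N]] with
  | Some j => if kbasis n E d i p && standard n d E q.2
              then ((-1) ^+ #|[set k in p.1 | (k < j)%N]|)%R else 0%R
  | None => 0%R
  end.

Definition kmat (K : fieldType) (n : nat) (E : rel 'I_n) (d i : nat)
    : 'M[K]_(#|{: kindex n d}|) :=
  \matrix_(a, b) kentry K n E d i (enum_val a) (enum_val b).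

Definition betti (K : fieldType) (n : nat) (E : rel 'I_n) (i d : nat) : nat :=
  (#|[set p : kindex n d | kbasis n E d i p]| - \rank (kmat K n E d i)
     - \rank (kmat K n E d i.+1))%N.

Definition reg_eq (K : fieldType) (n : nat) (E : rel 'I_n) (r : nat) : Prop :=
  (exists i, betti K n E i (i + r) != 0%N) /\
  (forall i d, betti K n E i d != 0%N -> (d <= i + r)%N).

(* Main.v *)
Require Import Defs.
From mathcomp Require Import all_boot all_algebra.
From mathcomp Require Import zify.

Import GRing.Theory.

Set Implicit Arguments.
Unset Strict Implicit.
Unset Printing Implicit Defensive.

(* The Koszul complex splits by multidegree and, once the monomial is non-constant, by the copy of
   the [m]-cycle containing its support.  Discrete Morse theory is run on the basis cells [(F, u)]:
   if the multidegree has an entry at least 2, moving that variable between [F] and [u] is a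
   perfect matching; otherwise the cycle is scanned from a vertex missing from the multidegree and
   the first vertex that can be moved freely is moved.  The cells left over are the "stars": the
   support of [u] is a set of [r] vertices of the cycle at pairwise distance at least 3, each one
   preceded by a vertex of [F].  Each block contains at most one star, so there are no
   cancellations and the Betti number counts stars: [l] copies, [m/(m-2r) * C(m-2r, r)] supports,
   and a free choice of the [i - r] other elements of [F] among [(l-1)m + r] vertices.  Multidegrees
   containing a whole copy of the cycle only contribute when [r] is the regularity. *)

(** * Matchings and ranks of matrices indexed by a finite type *)

(** The constant monomial lies in no copy, and its multiples reach all of them, so the linear strand
    does not split by copies. All homology is therefore computed for [i.+1 < d]; this suffices
    because [m >= 5] makes [(m + 1) %/ 3] at least 2. Cells of degree [i] and [i.+1] then carry
    nonconstant monomials, but those of degree [i.+2] may not: hence the parameter [k], the copy to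
    which a constant monomial is assigned. No Morse complex is built. As [betti] is a difference of
    ranks, a triangular submatrix in each degree bounds it above by the number of unmatched cells.
    The bound is attained below the regularity because stars are cycles and no unmatched cell one
    degree higher shares their block: a gap, the multidegree and the copy determine the star. The
    number [(m + 1) %/ 3] comes from the independence complex of the [m]-cycle, whose reduced
    homology sits in a single degree. A multidegree containing a whole copy sees that cycle; one
    with a gap only sees paths, each contractible or a sphere up to homotopy. *)

Section FinMatrix.
Context {K : fieldType} {T : finType}.
Implicit Types (f : T -> T -> K) (A C S Z : {set T}).
Local Open Scope ring_scope.

Definition fmx f : 'M[K]_#|T| := \matrix_(a, b) f (enum_val a) (enum_val b).

Lemma sum_enum_rank (F : T -> K) : \sum_(a < #|T|) F (enum_val a) = \sum_p F p.
Proof.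
rewrite [RHS](reindex (@enum_val T predT)) //=.
by exists enum_rank => x _; rewrite ?enum_valK ?enum_rankK.
Qed.

Lemma fmx_mul_eq0 f1 f2 :
  (fmx f1 *m fmx f2 = 0) <-> (forall p q, \sum_s f1 p s * f2 s q = 0).
Proof.
split=> [h p q|h].
  have /matrixP/(_ (enum_rank p) (enum_rank q)) := h; rewrite !mxE.
  under eq_bigr do rewrite !mxE !enum_rankK.
  by rewrite (sum_enum_rank (fun s => f1 p s * f2 s q)).
apply/matrixP=> a b; rewrite !mxE; under eq_bigr do rewrite !mxE.
by rewrite (sum_enum_rank (fun s => f1 (enum_val a) s * f2 s (enum_val b))).
Qed.

Definition fdiag A p q : K := ((p == q) && (p \in A))%:R.

Lemma sum_fdiagl A p (F : T -> K) : \sum_s fdiag A p s * F s = (p \in A)%:R * F p.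
Proof.
rewrite (bigD1 p) //= big1 ?addr0 /fdiag ?eqxx //= => s; rewrite eq_sym => /negPf->.
by rewrite mul0r.
Qed.

Lemma sum_fdiagr A p (F : T -> K) : \sum_s F s * fdiag A s p = F p * (p \in A)%:R.
Proof.
rewrite (bigD1 p) //= big1 ?addr0 /fdiag ?eqxx //= => s /negPf->.
by rewrite mulr0.
Qed.

Lemma fmx_diagl A f : (forall p q, f p q != 0 -> p \in A) ->
  fmx (fdiag A) *m fmx f = fmx f.
Proof.
move=> h; apply/matrixP=> a b; rewrite !mxE; under eq_bigr do rewrite !mxE.
rewrite (sum_enum_rank (fun s => fdiag A (enum_val a) s * f s (enum_val b))) sum_fdiagl.
have [->|/h->] := eqVneq (f (enum_val a) (enum_val b)) 0; first by rewrite mulr0.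
by rewrite mul1r.
Qed.

Lemma fmx_diagr A f : (forall p q, f p q != 0 -> q \in A) ->
  fmx f *m fmx (fdiag A) = fmx f.
Proof.
move=> h; apply/matrixP=> a b; rewrite !mxE; under eq_bigr do rewrite !mxE.
rewrite (sum_enum_rank (fun s => f (enum_val a) s * fdiag A s (enum_val b))) sum_fdiagr.
have [->|/h->] := eqVneq (f (enum_val a) (enum_val b)) 0; first by rewrite mul0r.
by rewrite mulr1.
Qed.

Lemma rank_fdiag_le A : (\rank (fmx (fdiag A)) <= #|A|)%N.
Proof.
pose M : 'M[K]_(#|T|, #|A|) := \matrix_(a, b) (enum_val a == enum_val b)%:R.
have -> : fmx (fdiag A) = M *m M^T.
  apply/matrixP=> a b; rewrite !mxE /fdiag; have [aA|aA] := boolP (enum_val a \in A).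
    rewrite andbT (bigD1 (enum_rank_in aA (enum_val a))) //= !mxE enum_rankK_in // eqxx mul1r.
    rewrite [enum_val b == _]eq_sym big1 ?addr0 // => c hc; rewrite !mxE.
    have [e|] := eqVneq (enum_val a) (enum_val c); last by rewrite mul0r.
    case/eqP: hc; apply: enum_val_inj; rewrite enum_rankK_in //.
  rewrite andbF big1 // => c _; rewrite !mxE.
  have [e|] := eqVneq (enum_val a) (enum_val c); last by rewrite mul0r.
  by move: aA; rewrite e enum_valP.
exact: leq_trans (mxrankM_maxl _ _) (rank_leq_col _).
Qed.

(* [mu] pairs every [p] of [S] with a column so that the square submatrix of [f] on rows
   [S] and columns [mu S] is triangular for the order given by [h]. *)
Definition acyclic_on f (S : {set T}) (mu : T -> T) (h : T -> nat) :=
  (forall p, p \in S -> f p (mu p) != 0) /\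
  (forall p q, p \in S -> q \in S -> p != q -> f p (mu q) != 0 -> (h q < h p)%N).

Section Triangular.
Context {f : T -> T -> K} {S : {set T}} {mu : T -> T} {h : T -> nat}.
Context (fS : acyclic_on f S mu h).

(** At a nonzero coordinate of maximal height, the matching equation keeps only its diagonal
    term. *)
Lemma triangular_inj (x : T -> K) :
  (forall q, q \in S -> \sum_(p in S) x p * f p (mu q) = 0) ->
  forall p, p \in S -> x p = 0.
Proof.
move=> hx p0 p0S; apply/eqP; apply: contraT => xp0.
have [p /andP[pS xp] pmax] :=
  @arg_maxnP T p0 (fun p => (p \in S) && (x p != 0)) h (introT andP (conj p0S xp0)).
have := hx p pS; rewrite (bigD1 p) //= big1 ?addr0.
  by move/eqP; rewrite mulf_eq0 (negPf xp) (negPf (fS.1 p pS)).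
move=> q /andP[qS qp]; have [->|xq] := eqVneq (x q) 0; first by rewrite mul0r.
have [->|fq] := eqVneq (f q (mu p)) 0; first by rewrite mulr0.
have /= := pmax q; rewrite qS xq => /(_ isT) hqp.
by have := leq_trans (fS.2 q p qS pS qp fq) hqp; rewrite ltnn.
Qed.

Let M : 'M[K]_#|S| := \matrix_(a, b) f (enum_val a) (mu (enum_val b)).

Lemma sum_enum_in (F : T -> K) : \sum_(a < #|S|) F (enum_val a) = \sum_(p in S) F p.
Proof. by rewrite [RHS]big_enum_val. Qed.

Let M_free : row_free M.
Proof.
apply: inj_row_free => v vM; apply/rowP=> a; rewrite !mxE.
(* The row vector [v], indexed by [S], is extended by zero to all of [T]. *)
pose x p := if p \in S =P true is ReflectT pS then v 0 (enum_rank_in pS p) else 0.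
have xE b : x (enum_val b) = v 0 b.
  rewrite /x; case: eqP => [pS|/(_ (enum_valP b))//].
  by rewrite enum_valK_in.
rewrite -xE; apply: triangular_inj (enum_valP a) => q qS.
rewrite -sum_enum_in; move/rowP: vM => /(_ (enum_rank_in qS q)); rewrite !mxE => e.
rewrite -[RHS]e; by apply: eq_bigr => b _; rewrite !mxE enum_rankK_in // xE.
Qed.

Lemma triangular_surj (y : T -> K) :
  exists x : T -> K, forall q, q \in S -> \sum_(p in S) x p * f p (mu q) = y q.
Proof.
pose v := (\row_b y (enum_val b)) *m invmx M.
pose x p := if p \in S =P true is ReflectT pS then v 0 (enum_rank_in pS p) else 0.
have xE b : x (enum_val b) = v 0 b.
  rewrite /x; case: eqP => [pS|/(_ (enum_valP b))//].
  by rewrite enum_valK_in.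
exists x => q qS; rewrite -sum_enum_in.
have /rowP/(_ (enum_rank_in qS q)) : v *m M = \row_b y (enum_val b).
  by rewrite mulmxKV // -row_free_unit.
rewrite [X in _ = X -> _]mxE enum_rankK_in // => e; rewrite -[RHS]e mxE.
by apply: eq_bigr => b _; rewrite [M _ _]mxE enum_rankK_in // xE.
Qed.

Lemma rank_triangular : (#|S| <= \rank (fmx f))%N.
Proof.
have <- : \rank M = #|S| by apply/eqP.
have -> : M = rowsub (fun a => enum_rank (enum_val a)) 1%:M *m fmx f *m
              colsub (fun a => enum_rank (mu (enum_val a))) 1%:M.
  rewrite mulmx_colsub mulmx1 mul_rowsub_mx mul1mx.
  by apply/matrixP=> a b; rewrite !mxE !enum_rankK.
exact: leq_trans (mxrankM_maxl _ _) (mxrankM_maxr _ _).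
Qed.

End Triangular.

Lemma rank_fdiag A : \rank (fmx (fdiag A)) = #|A|.
Proof.
apply/eqP; rewrite eqn_leq rank_fdiag_le.
apply: (@rank_triangular _ _ id (fun=> 0%N)); split=> [p pA|p q _ _ /negPf pq].
  by rewrite /fdiag eqxx pA oner_eq0.
by rewrite /fdiag pq eqxx.
Qed.

(** The last hypothesis says that a boundary supported on [Z] is zero, so the image of [f2] and the
    span of [Z] are independent inside the kernel of [f1] on [C]. The additive form suits the
    truncated subtractions in [betti]. *)
Lemma homology_rank_lower f2 f1 C Z :
  fmx f2 *m fmx f1 = 0 ->
  (forall p q, f1 p q != 0 -> p \in C) -> (forall p q, f2 p q != 0 -> q \in C) ->
  Z \subset C -> (forall c q, c \in Z -> f1 c q = 0) ->
  (forall y : T -> K, (forall q, q \notin Z -> \sum_p y p * f2 p q = 0) ->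
     forall q, q \in Z -> \sum_p y p * f2 p q = 0) ->
  (\rank (fmx f2) + #|Z| + \rank (fmx f1) <= #|C|)%N.
Proof.
move=> f21 f1C f2C ZC Z1 Zim.
have dZ : (fmx f2 :&: fmx (fdiag Z))%MS = 0.
  apply/eqP; rewrite -submx0; apply/rV_subP=> v; rewrite sub_capmx.
  case/andP=> /submxP[y vy] /submxP[z vz]; rewrite submx0; apply/eqP/rowP=> b.
  have vE a : v 0 a = z 0 a * (enum_val a \in Z)%:R.
    rewrite vz mxE; under eq_bigr do rewrite mxE.
    rewrite (bigD1 a) //= big1 /fdiag ?addr0 ?eqxx // => c /negPf ca.
    by rewrite (inj_eq enum_val_inj) ca mulr0.
  rewrite vE mxE; have [bZ|] := boolP (enum_val b \in Z); last by rewrite mulr0.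
  have vyE q : v 0 (enum_rank q) = \sum_p y 0 (enum_rank p) * f2 p q.
    rewrite vy mxE -sum_enum_rank.
    by apply: eq_bigr => a _; rewrite !mxE enum_valK enum_rankK.
  have := Zim (fun p => y 0 (enum_rank p)) _ _ bZ.
  rewrite -vyE enum_valK vE bZ mulr1; apply=> q qZ.
  by rewrite -vyE vE enum_rankK (negPf qZ) mulr0.
have sub : (fmx f2 + fmx (fdiag Z) <= fmx (fdiag C) :&: kermx (fmx f1))%MS.
  rewrite addsmx_sub !sub_capmx -(fmx_diagr f2C) submxMl /=.
  rewrite (fmx_diagr f2C); apply/and3P; split; first exact/sub_kermxP.
    have <- : fmx (fdiag Z) *m fmx (fdiag C) = fmx (fdiag Z).
      apply: fmx_diagr => p q; rewrite /fdiag; have [<-|] := eqVneq p q; last by rewrite eqxx.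
      by have [pZ _|] := boolP (p \in Z); [exact: (subsetP ZC)|rewrite eqxx].
    exact: submxMl.
  apply/sub_kermxP/fmx_mul_eq0 => p q; rewrite sum_fdiagl.
  by have [/Z1->|] := boolP (p \in Z); rewrite ?mulr0 ?mul0r.
have := mxrank_mul_ker (fmx (fdiag C)) (fmx f1); rewrite fmx_diagl // rank_fdiag => <-.
by rewrite addnC leq_add2l -(rank_fdiag Z) -mxrank_disjoint_sum // mxrankS.
Qed.

(* Adding a boundary [x f1] to [y] clears [y] on [mu1 S1]; what remains in the block [B]
   lives on [S2], where the matching of [f2] makes it vanish. *)
Lemma morse_image0 f1 f2 S1 mu1 h1 S2 mu2 h2 (B : {set T}) (y : T -> K) :
  fmx f1 *m fmx f2 = 0 -> acyclic_on f1 S1 mu1 h1 -> acyclic_on f2 S2 mu2 h2 ->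
  (forall p q, f2 p q != 0 -> (p \in B) = (q \in B)) ->
  (forall p q, p \in B -> f2 p q != 0 -> p \in S2 \/ p \in mu1 @: S1) ->
  (forall q, q \in S2 -> \sum_p y p * f2 p (mu2 q) = 0) ->
  forall q, q \in B -> \sum_p y p * f2 p q = 0.
Proof.
move=> /fmx_mul_eq0 f12 ac1 ac2 fB cov y0.
have [x xy] := triangular_surj ac1 (fun q => y (mu1 q)).
pose y' p := y p - \sum_(s in S1) x s * f1 s p.
have y'f q : \sum_p y' p * f2 p q = \sum_p y p * f2 p q.
  under eq_bigr do rewrite mulrBl; rewrite sumrB; apply/eqP; rewrite subr_eq addrC -subr_eq subrr.
  under eq_bigr do rewrite mulr_suml; rewrite exchange_big /= eq_sym big1 // => s _.
  by under eq_bigr do rewrite -mulrA; rewrite -mulr_sumr f12 mulr0.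
(* Cutting [y'] down to [B] is harmless, since [f2] never links [B] to its complement. *)
pose z p := if p \in B then y' p else 0.
have zE q : q \in B -> \sum_(p in S2) z p * f2 p q = \sum_p y' p * f2 p q.
  move=> qB; rewrite [RHS](bigID (mem S2)) /= [X in _ + X]big1 ?addr0.
    apply: eq_bigr => p pS; rewrite /z; case: ifP => // pB.
    have [->|/fB] := eqVneq (f2 p q) 0; first by rewrite !mulr0.
    by rewrite pB qB.
  move=> p pS; have [->|fpq] := eqVneq (f2 p q) 0; first by rewrite mulr0.
  have pB : p \in B by rewrite (fB _ _ fpq).
  case: (cov p q pB fpq) => [|/imsetP[s sS ->]]; first by rewrite (negPf pS).
  by rewrite /y' xy // subrr mul0r.
have z0 p : p \in S2 -> z p = 0.
  apply: (triangular_inj ac2) => q qS.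
  have [qB|qB] := boolP (mu2 q \in B); first by rewrite zE // y'f y0.
  rewrite big1 // => s _; rewrite /z; case: ifP => [sB|]; last by rewrite mul0r.
  have [->|/fB] := eqVneq (f2 s (mu2 q)) 0; first by rewrite mulr0.
  by rewrite sB (negPf qB).
move=> q qB; rewrite -y'f -zE // big1 // => p pS.
by rewrite z0 // mul0r.
Qed.

End FinMatrix.

(** * The Koszul complex *)

Section Koszul.
Context {K : fieldType} {n : nat} (E : rel 'I_n) {d : nat}.
Implicit Types (p q s : kindex n d) (i : nat) (j v : 'I_n).

Definition up p j : kindex n d := (p.1 :\ j, [ffun v => inord (p.2 v + (v == j))]).

Definition multideg p v : nat := p.2 v + (v \in p.1).

Lemma expo_le_mdeg (e : expo n d) v : e v <= mdeg n d e.
Proof. by rewrite /mdeg (bigD1 v) //= leq_addr. Qed.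

Lemma standardP (e : expo n d) :
  reflect (forall u v, 0 < e u -> 0 < e v -> ~~ E u v) (standard n d E e).
Proof.
apply: (iffP forallP) => [h u v eu ev|h u].
  by apply/negP=> /(implyP (forallP (h u) v)); rewrite !eqn0Ngt eu ev.
apply/forallP=> v; apply/implyP=> Euv; rewrite !eqn0Ngt -negb_and.
by apply/negP=> /andP[eu ev]; have := h u v eu ev; rewrite Euv.
Qed.

Lemma standard_le (e e' : expo n d) :
  (forall v, 0 < e v -> 0 < e' v) -> standard n d E e' -> standard n d E e.
Proof. by move=> h /standardP st; apply/standardP=> u v /h eu /h; exact: st. Qed.

(** A nonempty [F] uses up part of the degree [d], so one more variable still fits in the exponents
    and the [inord] in [up] never takes its default value. *)
Lemma kbasis_lt i p : kbasis n E d i p -> 0 < #|p.1| -> forall v, p.2 v < d.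
Proof.
case/and4P=> /eqP ci id /eqP md _ cp v; apply: leq_ltn_trans (expo_le_mdeg p.2 v) _.
by rewrite md ltn_subrL -ci cp /= (leq_trans cp) // ci.
Qed.

Lemma up_expo i p j : kbasis n E d i p -> j \in p.1 ->
  forall v, (up p j).2 v = p.2 v + (v == j) :> nat.
Proof.
move=> kp jp v; rewrite ffunE inordK //.
have cp : 0 < #|p.1| by apply/card_gt0P; exists j.
by have := kbasis_lt kp cp v; case: eqP => _; rewrite ?addn0 ?addn1 ltnS // => /ltnW.
Qed.

Lemma multideg_up i p j : kbasis n E d i p -> j \in p.1 -> multideg (up p j) =1 multideg p.
Proof.
move=> kp jp v; rewrite /multideg (up_expo kp jp) !inE -addnA; congr (_ + _).
by have [->|] := eqVneq v j; rewrite ?jp.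
Qed.

Lemma kbasis_up i p j : kbasis n E d i.+1 p -> j \in p.1 ->
  standard n d E (up p j).2 -> kbasis n E d i (up p j).
Proof.
move=> kp jp st; have /and4P[/eqP ci id /eqP md _] := kp.
apply/and4P; split=> //; last 1 first.
- rewrite /mdeg; under eq_bigr do rewrite (up_expo kp jp).
  rewrite big_split /= (bigD1 j) //= [X in _ + X](bigD1 j) //= eqxx [X in _ + (_ + X)]big1.
    by move: md; rewrite /mdeg (bigD1 j) //= => ->; rewrite addn0 addn1 subnSK.
  by move=> v /negPf->.
- by move: ci; rewrite (cardsD1 j) jp => /eqP.
- exact: ltnW.
Qed.

Definition ksign (F : {set 'I_n}) j : K := ((-1) ^+ #|[set k in F | (k < j)%N]|)%R.

Lemma kentry_up i p j : kbasis n E d i p -> j \in p.1 -> standard n d E (up p j).2 ->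
  kentry K n E d i p (up p j) = ksign p.1 j.
Proof.
move=> kp jp st; rewrite /kentry; case: pickP => [j'|/(_ j)].
  case/andP=> j'p /andP[/eqP ejj' _]; have -> : j' = j.
    apply/eqP; apply: contraT => jj'; have : j' \in p.1 :\ j' by rewrite -ejj' !inE jj' j'p.
    by rewrite !inE eqxx.
  by rewrite kp st.
by rewrite jp eqxx /=; case: forallP => // -[] k; rewrite (up_expo kp jp).
Qed.

Lemma kentry_neq0 i p q : kentry K n E d i p q != 0%R ->
  kbasis n E d i p /\ exists2 j, j \in p.1 & q = up p j /\ standard n d E q.2.
Proof.
rewrite /kentry; case: pickP => [j /andP[jp /andP[/eqP e1 /forallP e2]]|_]; last by rewrite eqxx.
case: ifP => [/andP[kp st] _|]; last by rewrite eqxx.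
split=> //; exists j => //; split=> //; case: q e1 e2 st => [F e] /= -> e2 _.
congr pair; apply/ffunP=> v; apply/val_inj.
by apply: etrans (eqP (e2 v)) _; rewrite -(up_expo kp jp).
Qed.

Lemma kentry_kbasis i p q : kentry K n E d i.+1 p q != 0%R -> kbasis n E d i q.
Proof. by case/kentry_neq0=> kp [j jp [-> st]]; exact: kbasis_up. Qed.

Lemma kentry_multideg i p q : kentry K n E d i p q != 0%R -> multideg p =1 multideg q.
Proof. by case/kentry_neq0=> kp [j jp [-> _]] v; rewrite (multideg_up kp jp). Qed.

Local Open Scope ring_scope.

(** Replacing the [pick] by a sum with at most one nonzero term makes the composite of two
    differentials a double sum whose terms cancel in pairs. *)
Lemma kentryE i p q : kbasis n E d i p ->
  kentry K n E d i p q =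
  \sum_(j in p.1) (q == up p j)%:R * (standard n d E q.2)%:R * ksign p.1 j.
Proof.
move=> kp; have up_inj j j' : j \in p.1 -> up p j = up p j' -> j = j'.
  move=> jp [/setP/(_ j) + _]; rewrite !inE eqxx jp /=.
  by case: eqP.
have [q0|] := eqVneq (kentry K n E d i p q) 0; last first.
  case/kentry_neq0=> _ [j jp [-> st]]; rewrite kentry_up // (bigD1 j) //= eqxx st !mul1r.
  rewrite big1 ?addr0 // => j' /andP[j'p /negPf jj'].
  by case: eqP => [/(up_inj _ _ jp)/eqP|]; rewrite ?mul0r // eq_sym jj'.
rewrite q0 big1 // => j jp; case: eqP => [eq|]; last by rewrite !mul0r.
move: q0; rewrite eq; case: (boolP (standard _ _ _ _)) => st; last by rewrite mulr0 mul0r.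
by rewrite kentry_up // => ->; rewrite mulr0.
Qed.

Lemma ksign_anti (F : {set 'I_n}) j j' : j \in F -> j' \in F -> j != j' ->
  ksign F j * ksign (F :\ j) j' = - (ksign F j' * ksign (F :\ j') j).
Proof.
wlog lt : j j' / (j < j')%N => [W jF j'F jj'|jF j'F jj'].
  have [lt|lt|/val_inj e] := ltngtP j j'; first exact: W.
    by rewrite [X in - X]W ?opprK // eq_sym.
  by rewrite e eqxx in jj'.
rewrite /ksign -!exprD.
have -> : [set k in F :\ j' | (k < j)%N] = [set k in F | (k < j)%N].
  apply/setP=> k; rewrite !inE; case: (ltnP k j) => [kj|]; rewrite ?andbF // !andbT.
  by have [e|//] := eqVneq k j'; move: kj; rewrite e ltnNge ltnW.
have -> : #|[set k in F | (k < j')%N]| = #|[set k in F :\ j | (k < j')%N]|.+1.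
  rewrite (cardsD1 j) !inE jF lt /= add1n; congr _.+1; apply: eq_card => k.
  by rewrite !inE andbA.
by rewrite addSn exprS mulN1r addnC opprK.
Qed.

Lemma up_comm i p j j' : kbasis n E d i p -> j \in p.1 -> j' \in p.1 ->
  up (up p j) j' = up (up p j') j.
Proof.
move=> kp jp j'p; have h := up_expo kp; congr pair.
  by apply/setP=> v; rewrite !inE andbCA.
by apply/ffunP=> v; rewrite [LHS]ffunE [RHS]ffunE; congr inord; rewrite !h // addnAC.
Qed.

Lemma sum_antisym (F : {set 'I_n}) (H : 'I_n -> 'I_n -> K) :
  (forall j j', j \in F -> j' \in F -> j != j' -> H j j' = - H j' j) ->
  \sum_(j in F) \sum_(j' in F :\ j) H j j' = 0.
Proof.
move=> anti.
have -> : \sum_(j in F) \sum_(j' in F :\ j) H j j' =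
  \sum_(j in F) \sum_(j' in F | (j < j')%N) H j j' + \sum_(j in F) \sum_(j' in F | (j' < j)%N) H j j'.
  rewrite -big_split; apply: eq_bigr => j jF.
  rewrite (bigID (fun j' : 'I_n => (j < j')%N)) /=; congr (_ + _); apply: eq_bigl => j'.
    by rewrite !inE; case: (j' \in F); rewrite ?andbF // andbT andb_idl // => jj'; rewrite -val_eqE gtn_eqF.
  by rewrite !inE; case: (j' \in F); rewrite ?andbF //= andbT -leqNgt ltn_neqAle -val_eqE.
rewrite [X in _ + X](exchange_big_dep (mem F)) //=; last by move=> ? ? _ /andP[].
rewrite -big_split big1 // => j jF /=.
rewrite [X in _ + X](eq_bigl (fun j' => (j' \in F) && (j < j')%N)); last by move=> j'; rewrite jF.
rewrite -big_split big1 // => j' /andP[j'F jj'] /=.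
by rewrite (anti j j') ?addNr // -val_eqE neq_ltn jj'.
Qed.

Lemma koszul_complex i :
  fmx (kentry K n E d i.+1) *m fmx (kentry K n E d i) = 0.
Proof.
apply/fmx_mul_eq0 => p s; have [kp|nkp] := boolP (kbasis n E d i.+1 p); last first.
  apply: big1 => q _; have [->|/kentry_neq0[]] := eqVneq (kentry K n E d i.+1 p q) 0.
    by rewrite mul0r.
  by rewrite (negPf nkp).
pose G j := (standard n d E (up p j).2)%:R * ksign p.1 j.
transitivity (\sum_(j in p.1) G j * kentry K n E d i (up p j) s).
  under eq_bigr do rewrite kentryE // mulr_suml.
  rewrite exchange_big /=; apply: eq_bigr => j jp.
  rewrite (bigD1 (up p j)) //= eqxx mul1r big1 ?addr0 // => q /negPf->.
  by rewrite !mul0r.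
pose H j j' := (s == up (up p j) j')%:R * (standard n d E s.2)%:R *
   (ksign p.1 j * ksign (p.1 :\ j) j').
rewrite -[RHS](@sum_antisym p.1 H); last first.
  by move=> j j' jp j'p jj'; rewrite /H (up_comm kp) // ksign_anti // mulrN.
apply: eq_bigr => j jp; rewrite /G; have [st|st] := boolP (standard n d E (up p j).2).
  rewrite mul1r kentryE; last exact: kbasis_up.
  by rewrite mulr_sumr; apply: eq_bigr => j' _; rewrite mulrCA.
(* If the first move lands in the ideal, so does the double move, which only multiplies further:
   both sides vanish. *)
rewrite !mul0r big1 // => j' j'F; rewrite /H; case: eqP => [es|]; last by rewrite !mul0r.
case: (boolP (standard _ _ _ s.2)) => sts; rewrite ?mulr0 ?mul0r //.
case/negP: st; apply: standard_le sts => v; rewrite es.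
have -> : (up (up p j) j').2 v = inord ((up p j).2 v + (v == j')) by rewrite [LHS]ffunE.
rewrite (up_expo kp jp) => h.
move: j'F; rewrite !inE => /andP[jj' j'p].
have cp : (0 < #|p.1|)%N by apply/card_gt0P; exists j.
have lt := kbasis_lt kp cp v; rewrite inordK; first by rewrite addn_gt0 h.
rewrite -addnA ltnS.
apply: leq_trans lt; rewrite -[X in (_ <= X)%N]addn1 leq_add2l.
by have [->|_] := eqVneq v j; rewrite ?leq_b1 // eq_sym (negPf jj').
Qed.

End Koszul.

Lemma bettiE (K : fieldType) (n : nat) (E : rel 'I_n) (i d : nat) :
  betti K n E i d = #|[set p : kindex n d | kbasis n E d i p]|
    - \rank (fmx (kentry K n E d i)) - \rank (fmx (kentry K n E d i.+1)).
Proof. by []. Qed.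

(** * Scanning a cycle *)

Ltac nlia :=
  repeat match goal with
  | H : is_true (leq _ _) |- _ => revert H
  | H : is_true (negb (leq _ _)) |- _ => revert H
  | H : is_true (negb (eq_op _ _)) |- _ => revert H
  | H : is_true (eq_op _ _) |- _ => revert H
  | H : is_true (andb _ _) |- _ => revert H
  | H : @eq ?T _ _ |- _ => unify T nat; revert H
  end; clear; lia.

Section Toggle.
Implicit Types (u w : nat -> bool) (m s t : nat).

(* [u] and [w] describe, along a cycle of length [m], an independent set and the vertex set
   containing it; position [0] is never toggled, and is outside [w] unless [w] is everything. *)
Definition toggleable u w m s :=
  [&& 0 < s, s < m, w s, ~~ u s.+1, ~~ u s.-1 & [|| s == 1, ~~ w s.-1 | u s.-2]].

Definition first_toggle u w m := find (toggleable u w m) (iota 0 m).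

Lemma first_toggleP u w m t : t < m -> first_toggle u w m = t <->
  toggleable u w m t /\ forall s, s < t -> ~~ toggleable u w m s.
Proof.
move=> tm; split=> [ft|[tt lt]].
  have hh : has (toggleable u w m) (iota 0 m) by rewrite has_find size_iota -/(first_toggle u w m) ft.
  have := nth_find 0 hh; rewrite -/(first_toggle u w m) ft nth_iota // => tt; split=> // s st.
  have := @before_find _ 0 (toggleable u w m) (iota 0 m) s.
  by rewrite -/(first_toggle u w m) ft st nth_iota ?(ltn_trans st tm) // add0n => ->.
have hh : has (toggleable u w m) (iota 0 m) by apply/hasP; exists t; rewrite ?mem_iota.
have := hh; rewrite has_find size_iota -/(first_toggle u w m) => fm.
have := nth_find 0 hh; rewrite -/(first_toggle u w m) nth_iota // add0n => tf.
apply/eqP; rewrite eqn_leq; apply/andP; split; rewrite leqNgt; apply/negP.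
  move=> lt'; have := @before_find _ 0 (toggleable u w m) (iota 0 m) t.
  by rewrite -/(first_toggle u w m) nth_iota // add0n tt => /(_ lt').
by move/lt; rewrite tf.
Qed.

Lemma first_toggle_none u w m : m <= first_toggle u w m -> forall s, ~~ toggleable u w m s.
Proof.
rewrite leqNgt -[X in _ < X](size_iota 0 m) -has_find => /hasPn h s.
case: (ltnP s m) => sm; first by apply: h; rewrite mem_iota.
by rewrite /toggleable [s < m]ltnNge sm /= andbF.
Qed.

(** This is the purpose of the last clause of [toggleable]. Membership of [t] in [u] is not tested
    at [t], and before [t] only at [t.-1]. The clause makes [t.-1] the origin, absent from [w], or
    blocked by [t.-2], so it cannot be toggled whatever [u t] is. *)
Lemma first_toggle_local u u' w m t : t < m -> first_toggle u w m = t ->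
  (forall s, s <= t.+1 -> s != t -> u' s = u s) -> first_toggle u' w m = t.
Proof.
move=> tm /(first_toggleP _ _ tm)[tt lt] uu; apply/(first_toggleP _ _ tm).
have t0 : 0 < t by case/andP: tt.
split=> [|s st].
  by move: tt; rewrite /toggleable !uu; lia.
have [est|ne] := eqVneq s.+1 t; last by move: (lt s st); rewrite /toggleable !uu; lia.
move: tt; rewrite /toggleable -est /= => /and5P[_ _ _ _ h].
have [s0|s0] := posnP s; first by rewrite s0.
apply/negP=> /and5P[_ _ ws _ /andP[us _]].
by move: h us; rewrite uu ?ws /=; lia.
Qed.

End Toggle.

Section Cycle.
Context {l m : nat}.
Local Notation V := 'I_(l * m).
Implicit Types (u v x y g : V) (s t : nat).

(** The copies of the cycle are the residue classes modulo [l]; [turn s] advances [s] steps inside a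
    copy. *)
Definition turn s v : V := Ordinal (ltn_pmod (v + s * l) (leq_ltn_trans (leq0n v) (ltn_ord v))).

Lemma gt0_l v : 0 < l. Proof. by case: v => v; case: l. Qed.
Lemma gt0_m v : 0 < m. Proof. by case: v => v; case: m => //; rewrite muln0. Qed.

Lemma turn_copy s v : turn s v %% l = v %% l.
Proof. by rewrite /= modn_dvdm ?dvdn_mulr // addnC modnMDl. Qed.

Lemma turn_add s t v : turn s (turn t v) = turn (t + s) v.
Proof. by apply/val_inj; rewrite /= modnDml mulnDl addnA. Qed.

Lemma turn_addm s v : turn (s + m) v = turn s v.
Proof. by apply/val_inj; rewrite /= mulnDl addnA [m * l]mulnC modnDr. Qed.

Lemma turn0 v : turn 0 v = v.
Proof. by apply/val_inj; rewrite /= mul0n addn0 modn_small. Qed.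

Lemma turnm v : turn m v = v.
Proof. by rewrite -[RHS]turn0 -[RHS]turn_addm add0n. Qed.

Lemma turn_predK v : turn m.-1 (turn 1 v) = v.
Proof. by rewrite turn_add add1n (prednK (gt0_m v)) turnm. Qed.

Lemma turn_succK v : turn 1 (turn m.-1 v) = v.
Proof. by rewrite turn_add addn1 (prednK (gt0_m v)) turnm. Qed.

Lemma turn_pred t g : 0 < t -> turn m.-1 (turn t g) = turn t.-1 g.
Proof.
move=> t0; rewrite turn_add (_ : t + m.-1 = t.-1 + m) ?turn_addm //.
by have := gt0_m g; clear -t0; lia.
Qed.

(** For [y] in the copy of [g], the number of steps from [g] to [y]; adding [l * m - g] avoids a
    negative difference. *)
Definition relpos g y := ((y + (l * m - g)) %% (l * m)) %/ l.

Lemma relpos_turn s g : s < m -> relpos g (turn s g) = s.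
Proof.
move=> sm; have gn := ltn_ord g; rewrite /relpos /= modnDml.
have -> : g + s * l + (l * m - g) = s * l + l * m by lia.
have l0 := gt0_l g.
by rewrite modnDr modn_small ?mulnK // mulnC ltn_mul2l l0.
Qed.

Lemma turn_inj s t g : s < m -> t < m -> turn s g = turn t g -> s = t.
Proof. by move=> sm tm e; rewrite -(relpos_turn g sm) e relpos_turn. Qed.

Lemma relpos_lt g y : relpos g y < m.
Proof.
rewrite /relpos ltn_divLR ?(gt0_l g) // [X in _ < X]mulnC.
exact: ltn_pmod (leq_ltn_trans (leq0n g) (ltn_ord g)).
Qed.

Lemma relposK g y : y %% l = g %% l -> turn (relpos g y) g = y.
Proof.
move=> yg; apply/val_inj; rewrite /= /relpos.
have gn := ltn_ord g; have yn := ltn_ord y.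
have dl : l %| (y + (l * m - g)) %% (l * m).
  rewrite /dvdn modn_dvdm ?dvdn_mulr // -modnDml yg modnDml subnKC; last exact: ltnW.
  by rewrite modnMr.
rewrite divnK // modnDmr (_ : g + _ = y + l * m); last by lia.
by rewrite modnDr modn_small.
Qed.

Lemma turn_neq s t g : s < t -> t < s + m -> turn s g != turn t g.
Proof.
move=> st tm; apply/eqP=> e; have := turn_inj (s := 0) (t := t - s) (g := turn s g).
have m0 := gt0_m g; rewrite turn0 turn_add subnKC; last exact: ltnW.
by move/(_ m0); rewrite ltn_subLR ?(ltnW st) // => /(_ tm e); lia.
Qed.

Lemma shift_mod_eq (a b k n : nat) : a < b -> b < n -> 0 < k -> k.*2 <= n ->
  ((b == (a + k) %% n) = (b - a == k)) * ((a == (b + k) %% n) = (n - (b - a) == k)).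
Proof.
move=> ab bn k0 kn; split.
  case: (ltnP (a + k) n) => h; first by rewrite modn_small //; lia.
  by rewrite -(subnK h) modnDr modn_small; lia.
case: (ltnP (b + k) n) => h; first by rewrite modn_small //; lia.
by rewrite -(subnK h) modnDr modn_small; lia.
Qed.

(** [l] divides the circular distance exactly when it divides the difference, so distinct copies are
    completely joined. Inside a copy only distance [l] remains, and [2 * l <= l * m] identifies it
    with one turn in either direction. *)
Lemma join_adjE u v : 1 < m -> circulant_adj (l * m) (join_S l m) u v =
  [|| u %% l != v %% l, v == turn 1 u | u == turn 1 v].
Proof.
move=> m1; have l0 := gt0_l u; have lm2 : l.*2 <= l * m by rewrite -muln2 leq_mul2l m1 orbT.
wlog uv : u v / u <= v => [W|].
  have [|/ltnW] := leqP u v; first exact: W.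
  move/W; rewrite /circulant_adj /circ_dist => e.
  transitivity (circulant_adj (l * m) (join_S l m) v u); last first.
    by rewrite /circulant_adj /circ_dist e eq_sym orbCA orbC -orbA; congr orb; exact: orbC.
  rewrite /circulant_adj /circ_dist; case: (ltngtP u v) => // -> //.
have [->|uvne] := eqVneq u v.
  rewrite /circulant_adj /circ_dist leqnn subnn min0n /= eqxx /= orbb.
  by rewrite -{1}[v]turn0 (negPf (turn_neq _ _ _)).
have {uvne} uv : u < v by rewrite ltn_neqAle uv andbT.
rewrite /circulant_adj /circ_dist (ltnW uv).
have un := ltn_ord u; have vn := ltn_ord v; set n := l * m in un vn lm2 *.
have -> : (v == turn 1 u) = (v - u == l) by rewrite -val_eqE /= mul1n; exact: (shift_mod_eq uv vn l0 lm2).1.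
have -> : (u == turn 1 v) = (n - (v - u) == l).
  by rewrite -val_eqE /= mul1n; exact: (shift_mod_eq uv vn l0 lm2).2.
have -> : (u %% l != v %% l) = ~~ (l %| minn (v - u) (n - (v - u))).
  rewrite eq_sym eqn_mod_dvd ?(ltnW uv) //; congr (~~ _).
  case: leqP => _ //; by rewrite [RHS]dvdn_subr ?dvdn_mulr // (leq_trans (leq_subr _ _) (ltnW vn)).
have D0 : 0 < v - u by rewrite subn_gt0.
have Dn : v - u < n by apply: leq_ltn_trans (leq_subr _ _) vn.
rewrite /join_S -/n; move: (v - u) D0 Dn => D D0 Dn; clear u v uv un vn m1.
case: (l %| minn D (n - D)) => /=; rewrite ?orbT ?orbF ?andbT; last by lia.
clearbody n; lia.
Qed.

End Cycle.

(** * The matching *)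

Section Matching.
Context {K : fieldType} {l m : nat} (m1 : 1 < m) {d : nat}.
Local Notation V := 'I_(l * m).
Local Notation E := (circulant_adj (l * m) (join_S l m)).
Local Notation cell := (kindex (l * m) d).
Local Notation stdE := (standard (l * m) d E).
Local Notation kb := (kbasis (l * m) E d).
Local Notation kent := (kentry K (l * m) E d).
Implicit Types (p q : cell) (x y v g : V) (i k s t : nat).

Lemma standard_joinP (e : expo (l * m) d) :
  reflect (forall x y, 0 < e x -> 0 < e y -> x %% l = y %% l /\ y != turn 1 x) (stdE e).
Proof.
apply: (iffP (standardP _ _)) => h x y ex ey.
  by have := h x y ex ey; rewrite join_adjE // !negb_or => /and3P[/negPn/eqP].
rewrite join_adjE // !negb_or; have [-> ->] := h x y ex ey.
by rewrite eqxx /=; case: (h y x ey ex).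
Qed.

(** The support of a standard monomial lies in one residue class, so the vertex picked does not
    matter; a constant monomial gets the default [k]. *)
Definition cell_copy k p : nat := if [pick x | 0 < p.2 x] is Some x then x %% l else k.

(* The origin from which copy [k] is scanned: a vertex missing from the multidegree [a],
   if there is one. *)
Definition origin (a : V -> nat) k : option V :=
  if [pick g : V | (g %% l == k) && (a g == 0)] is Some g then Some g
  else [pick g : V | g %% l == k].

Definition cell_toggle p g : nat :=
  first_toggle (fun s => 0 < p.2 (turn s g)) (fun s => 0 < multideg p (turn s g)) m.

Definition toggle_vertex k p : option V :=
  if [pick x | 1 < multideg p x] is Some x then Some x
  else if origin (multideg p) (cell_copy k p) is Some g then
    if cell_toggle p g < m then Some (turn (cell_toggle p g) g) else None
  else None.

Definition squarefree p := [forall x, multideg p x <= 1].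

Lemma origin_ext (a b : V -> nat) k : a =1 b -> origin a k = origin b k.
Proof.
move=> ab; rewrite /origin (@eq_pick _ _ (fun g : V => (g %% l == k) && (b g == 0))) //.
by move=> g; rewrite ab.
Qed.

Lemma origin_copy a k g : origin a k = Some g -> g %% l = k.
Proof.
rewrite /origin; case: pickP => [x /andP[/eqP e _] [<-] //|_].
by case: pickP => // x /eqP e [<-].
Qed.

Lemma origin_gap a k g x : origin a k = Some g -> x %% l = k -> a x = 0 -> a g = 0.
Proof.
rewrite /origin; case: pickP => [y /andP[_ /eqP e] [<-] //|h] _ xk ax.
by have := h x; rewrite xk ax !eqxx.
Qed.

Lemma origin_exists a x : exists g, origin a (x %% l) = Some g.
Proof.
rewrite /origin; case: pickP => [g _|_]; first by exists g.
by case: pickP => [g _|/(_ x)]; [exists g|rewrite eqxx].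
Qed.

Lemma pick_multideg_ext p q : multideg p =1 multideg q ->
  [pick x | 1 < multideg p x] = [pick x | 1 < multideg q x].
Proof. by move=> e; apply: eq_pick => x; rewrite e. Qed.

Lemma cell_copyE i k p x : kb i p -> 0 < p.2 x -> cell_copy k p = x %% l.
Proof.
case/and4P=> _ _ _ /standard_joinP st px; rewrite /cell_copy; case: pickP => [y py|/(_ x)].
  by case: (st y x py px).
by rewrite px.
Qed.

Lemma toggle_vertexP k p x : toggle_vertex k p = Some x ->
  (1 < multideg p x /\ [pick x | 1 < multideg p x] = Some x) \/
  [/\ squarefree p, [pick x | 1 < multideg p x] = None &
    exists g, [/\ origin (multideg p) (cell_copy k p) = Some g, cell_toggle p g < m
     & x = turn (cell_toggle p g) g]].
Proof.
rewrite /toggle_vertex; case: pickP => [y py [<-]|h]; first by left.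
case e: origin => [g|//]; case: ifP => // tm [<-]; right; split=> //; last by exists g.
by apply/forallP=> y; rewrite leqNgt h.
Qed.

Lemma toggle_vertex_sq k p g : [pick x | 1 < multideg p x] = None ->
  origin (multideg p) (cell_copy k p) = Some g -> cell_toggle p g < m ->
  toggle_vertex k p = Some (turn (cell_toggle p g) g).
Proof. by rewrite /toggle_vertex => -> -> ->. Qed.

Definition matched k i : {set cell} :=
  [set p | kb i p & if toggle_vertex k p is Some x then x \in p.1 else false].

Definition partner k p : cell := if toggle_vertex k p is Some x then up p x else p.

Definition height k p : nat :=
  if origin (multideg p) (cell_copy k p) is Some g then \sum_x relpos g x * p.2 x else 0.

Lemma cell_toggleP p g : cell_toggle p g < m ->
  let t := cell_toggle p g in
  [/\ 0 < t, 0 < multideg p (turn t g), p.2 (turn t.+1 g) = 0 :> nat,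
      p.2 (turn t.-1 g) = 0 :> nat &
     [\/ t = 1, multideg p (turn t.-1 g) = 0 | 0 < p.2 (turn t.-2 g)]].
Proof.
move=> tm t; have /(first_toggleP _ _ tm)[] : cell_toggle p g = t by [].
case/and5P=> t0 _ w u1 /andP[u2 h] _; split=> //; try by apply/eqP; rewrite eqn0Ngt.
by case/or3P: h => [/eqP h|h|h]; [apply: Or31|apply: Or32; apply/eqP; rewrite eqn0Ngt|apply: Or33].
Qed.

Lemma matched_standard k i p x : p \in matched k i -> toggle_vertex k p = Some x ->
  x \in p.1 /\ stdE (up p x).2.
Proof.
rewrite inE => /andP[kp + tx]; rewrite tx => xp; split=> //.
have /and4P[_ _ _ std] := kp.
have supE v : 0 < (up p x).2 v -> v = x \/ 0 < p.2 v.
  by rewrite (up_expo kp xp); case: eqVneq => [|_]; [left|rewrite addn0; right].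
case: (toggle_vertexP tx) => [[mx _]|[/forallP sq _ [g [og tm ex]]]].
  (* Here [x] already divides the monomial, so moving it leaves the support unchanged. *)
  have px : 0 < p.2 x by move: mx; rewrite /multideg xp addn1.
  by apply: standard_le std => v /supE[->|].
have [t0 _ u1 u2 _] := cell_toggleP tm.
have px : p.2 x = 0 :> nat by have := sq x; rewrite /multideg xp addn1 ltnS leqn0 => /eqP.
have r1 : p.2 (turn 1 x) = 0 :> nat by rewrite ex turn_add addn1.
have key y : 0 < p.2 y -> [/\ x %% l = y %% l, y != turn 1 x & x != turn 1 y].
  move=> py; split.
  - by rewrite ex turn_copy (origin_copy og) (cell_copyE k kp py).
  - by apply: contraTneq py => ->; rewrite r1.
  - apply: contraTneq py => e; rewrite -(turn_predK y) -e ex turn_add.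
    have -> : cell_toggle p g + m.-1 = (cell_toggle p g).-1 + m by have := gt0_m g; clear -t0; lia.
    by rewrite turn_addm u2.
apply/standard_joinP => y z /supE[->|py] /supE[->|pz].
- split=> //; rewrite -{1}[x]turn0; exact: turn_neq.
- by have [? ? ?] := key z pz; split.
- by have [? ? ?] := key y py; split.
- by move/standard_joinP: std => /(_ y z py pz).
Qed.

(** When [up p j = up q x] with [x] the toggle vertex of [q], the heights differ by the positions of
    [j] and [x], so the point is that [j] comes before [x]. If it came after, the scans of [p] and
    [q] would read the same data and [p] would also be toggled at [x], which is not in [p.1]. *)
Lemma acyclic_matched k i : acyclic_on (kent i) (matched k i) (partner k) (height k).
Proof.
split=> [p pm|p q pm qm pq].
  have := pm; rewrite inE => /andP[kp]; case tx: toggle_vertex => [x|//] xp.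
  have [_ st] := matched_standard pm tx.
  by rewrite /partner tx kentry_up // /ksign signr_eq0.
have := qm; rewrite inE => /andP[kq]; case tx: toggle_vertex => [x|//] xq.
rewrite /partner tx => /kentry_neq0[kp [j jp [upE st]]].
have mE : multideg p =1 multideg q.
  by move=> v; rewrite -(multideg_up kp jp) -upE (multideg_up kq xq).
have eE v : p.2 v + (v == j) = q.2 v + (v == x).
  by rewrite -(up_expo kp jp) -upE (up_expo kq xq).
have FE : p.1 :\ j = q.1 :\ x by case: upE => ->.
have jx : j != x.
  apply: contraNneq pq => jx; apply/eqP.
  case: p q {pm qm kp kq mE upE tx st} jp xq FE eE => [F e] [F' e'] /= jp xq FE eE.
  congr pair; first by rewrite -(setD1K jp) FE jx setD1K.
  by apply/ffunP=> v; apply/val_inj; have := eE v; rewrite jx => /addIn.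
have xp : x \notin p.1.
  apply/negP=> xp; have : x \in p.1 :\ j by rewrite !inE eq_sym jx.
  by rewrite FE !inE eqxx.
have ntp : toggle_vertex k p != Some x.
  by apply/eqP=> e; move: pm; rewrite inE e (negPf xp) andbF.
have qj : 0 < q.2 j by have := eE j; rewrite eqxx (negPf jx) addn0 => <-; rewrite addn1.
have px : 0 < p.2 x by have := eE x; rewrite eqxx eq_sym (negPf jx) addn0 => ->; rewrite addn1.
case: (toggle_vertexP tx) => [[mx px']|[sq pn [g [og tm ex]]]].
  by case/negP: ntp; rewrite /toggle_vertex (pick_multideg_ext mE) px'.
have xg : x %% l = g %% l by rewrite ex turn_copy.
have cq : cell_copy k q = x %% l by rewrite -(origin_copy og) xg.
have cp : cell_copy k p = x %% l by rewrite (cell_copyE k kp px).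
have jg : j %% l = g %% l by rewrite -(cell_copyE k kq qj) cq.
have ogp : origin (multideg p) (cell_copy k p) = Some g.
  by rewrite cp -cq -og; apply: origin_ext.
set t := cell_toggle q g in tm ex.
have [t0 _ u1 _ _] := cell_toggleP tm; rewrite -/t in t0 u1.
have ej := relposK jg; set s := relpos g j in ej; have sm : s < m := relpos_lt g j.
have st' : s != t by apply: contraNneq jx => e; rewrite -ej ex e.
have lt : s < t.
  rewrite ltn_neqAle st' /= leqNgt; apply/negP=> ts.
  (* The successor of a toggle vertex is not in the support, so [j] lies beyond everything that the
     scan reads up to [t]. *)
  have s1 : s != t.+1 by apply: contraTneq qj => e; rewrite -ej e u1.
  have agree s' : s' <= t.+1 -> s' != t -> p.2 (turn s' g) = q.2 (turn s' g) :> nat.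
    move=> s't ne; have := eE (turn s' g).
    have /negPf-> : turn s' g != j.
      by rewrite -ej; apply: turn_neq; move: s't ts sm s1; move: (s) (t) => a b; clear; lia.
    have /negPf-> : turn s' g != x; last by rewrite !addn0.
    rewrite ex; have [lt'|lt'|e] := ltngtP s' t; last by rewrite e eqxx in ne.
      by apply: turn_neq => //; move: tm lt'; move: (t) => b; clear; lia.
    by rewrite eq_sym; apply: turn_neq => //; move: tm t0 s't; move: (t) => b; clear; lia.
  have tp : cell_toggle p g = t.
    have <- : first_toggle (fun s => 0 < p.2 (turn s g)) (fun s => 0 < multideg q (turn s g)) m = t.
      by apply: (@first_toggle_local _ _ _ _ _ tm (erefl t)) => s' s't ne; rewrite agree.
    by rewrite /cell_toggle /first_toggle; apply: eq_find => s'; rewrite /toggleable !mE.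
  case/negP: ntp; apply/eqP; rewrite (@toggle_vertex_sq _ _ g) ?tp ?ex //.
  by rewrite (pick_multideg_ext mE).
rewrite /height og ogp; set hq := (X in X < _); set hp := (X in _ < X).
have tx' : relpos g x = t by rewrite ex relpos_turn.
suff : hp + s = hq + t by clearbody hp hq; clear -lt; lia.
have sumE y : relpos g y = \sum_v relpos g v * (v == y).
  by rewrite (bigD1 y) //= eqxx muln1 big1 ?addn0 // => v /negPf->; rewrite muln0.
rewrite /s -tx' (sumE j) (sumE x) -!big_split; apply: eq_bigr => v _ /=.
by rewrite -!mulnDr eE.
Qed.

End Matching.

(** * Critical cells *)

Section Critical.
Context {K : fieldType} {l m : nat} (m1 : 1 < m) {d : nat}.
Local Notation V := 'I_(l * m).
Local Notation E := (circulant_adj (l * m) (join_S l m)).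
Local Notation cell := (kindex (l * m) d).
Local Notation stdE := (standard (l * m) d E).
Local Notation kb := (kbasis (l * m) E d).
Implicit Types (p q : cell) (x y v g : V) (i k s t : nat).

Lemma toggle_copy k i p x : kb i p -> toggle_vertex k p = Some x -> cell_copy k p = x %% l.
Proof.
move=> kp /toggle_vertexP[[mx _]|[_ _ [g [og _ ->]]]]; last by rewrite turn_copy (origin_copy og).
by rewrite (cell_copyE m1 k kp (x := x)) //; move: mx; rewrite /multideg; case: (x \in p.1); nlia.
Qed.

Lemma toggle_flip k p p' x : toggle_vertex k p = Some x -> multideg p' =1 multideg p ->
  (forall v, v != x -> p'.2 v = p.2 v :> nat) -> cell_copy k p' = cell_copy k p ->
  toggle_vertex k p' = Some x.
Proof.
move=> tx mE eE cE; case: (toggle_vertexP tx) => [[_ px]|[_ pn [g [og tm ex]]]].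
  by rewrite /toggle_vertex (pick_multideg_ext mE) px.
have og' : origin (multideg p') (cell_copy k p') = Some g by rewrite cE -og; apply: origin_ext.
have [t0 _ _ _ _] := cell_toggleP tm; set t := cell_toggle p g in tm ex t0.
have tE : cell_toggle p' g = t.
  have <- : first_toggle (fun s => 0 < p'.2 (turn s g)) (fun s => 0 < multideg p (turn s g)) m = t.
    apply: (@first_toggle_local _ _ _ _ _ tm (erefl t)) => s st ne; rewrite eE // ex.
    have [lt|lt|e] := ltngtP s t; last by rewrite e eqxx in ne.
      by apply: turn_neq; nlia.
    by rewrite eq_sym; apply: turn_neq; nlia.
  by rewrite /cell_toggle /first_toggle; apply: eq_find => s; rewrite /toggleable !mE.
by rewrite (@toggle_vertex_sq _ _ _ _ _ g) ?tE ?ex // (pick_multideg_ext mE).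
Qed.

Lemma partner_toggle k i p : p \in matched k i -> toggle_vertex k (partner k p) = toggle_vertex k p.
Proof.
move=> pm; have := pm; rewrite inE => /andP[kp]; rewrite /partner.
case tx: (toggle_vertex k p) => [x|//] xp; have [_ st] := matched_standard m1 pm tx.
have i0 : 0 < i by have /and4P[/eqP<- _ _ _] := kp; apply/card_gt0P; exists x.
apply: (toggle_flip tx); first exact: multideg_up kp xp.
  by move=> v /negPf vx; rewrite (up_expo kp xp) vx addn0.
rewrite (toggle_copy kp tx); apply: (cell_copyE m1 k (i := i.-1)).
  by apply: kbasis_up => //; rewrite prednK.
by rewrite (up_expo kp xp) eqxx addn1.
Qed.

(** Putting [x] back into [F] gives the cell whose partner is [p]. The monomial may become constant
    in the process; the last hypothesis ensures that its copy is still that of [p]. *)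
Lemma partner_cover k i p x : kb i p -> toggle_vertex k p = Some x -> x \notin p.1 ->
  i.+1 < d \/ cell_copy k p = k -> p \in partner k @: matched k i.+1.
Proof.
move=> kp tx xp hk; have /and4P[/eqP ci id /eqP md std] := kp.
have px : 0 < p.2 x.
  case: (toggle_vertexP tx) => [[mx _]|[_ _ [g [_ tm ex]]]].
    by move: mx; rewrite /multideg (negPf xp); nlia.
  by have [_ + _ _ _] := cell_toggleP tm; rewrite -ex /multideg (negPf xp) addn0.
have mx : p.2 x <= d - i by rewrite -md expo_le_mdeg.
have id' : i < d by nlia.
pose p' : cell := (x |: p.1, [ffun v => inord (p.2 v - (v == x))]).
have eE v : p'.2 v = p.2 v - (v == x) :> nat.
  by rewrite ffunE inordK // ltnS (leq_trans (leq_subr _ _)) // -ltnS.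
have eE' v : p'.2 v + (v == x) = p.2 v.
  by rewrite eE subnK //; have [->|] := eqVneq v x.
have xp' : x \in p'.1 by rewrite !inE eqxx.
have md' : mdeg (l * m) d p'.2 = d - i.+1.
  suff : mdeg (l * m) d p'.2 + 1 = d - i by nlia.
  rewrite -md /mdeg -(eq_bigr _ (fun v _ => eE' v)) big_split /=; congr (_ + _).
  by rewrite (bigD1 x) //= eqxx big1 // => v /negPf->.
have kp' : kb i.+1 p'.
  apply/and4P; split=> //; first by rewrite cardsU1 xp ci.
    by rewrite md'.
  by apply: standard_le std => v; rewrite eE => h; apply: leq_trans h (leq_subr _ _).
have upE : up p' x = p.
  have -> : p = (p.1, p.2) by case: (p).
  congr pair; first by rewrite setU1K.
  by apply/ffunP=> v; apply/val_inj; rewrite /= -eE' -(up_expo kp' xp').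
have mE : multideg p' =1 multideg p by move=> v; rewrite -upE (multideg_up kp' xp').
have cE : cell_copy k p' = cell_copy k p.
  have [y py|no] := pickP (fun y => 0 < p'.2 y).
    by rewrite (cell_copyE m1 k kp' py) (cell_copyE m1 k kp (x := y)) // -eE' ltn_addr.
  case: hk => [hk|->]; last by rewrite /cell_copy; case: pickP => // y; rewrite no.
  suff : mdeg (l * m) d p'.2 = 0 by rewrite md'; nlia.
  by apply: big1 => y _; have := no y; case: (p'.2 y : nat).
have tx' : toggle_vertex k p' = Some x.
  by apply: (toggle_flip tx) => // v /negPf vx; rewrite eE vx subn0.
apply/imsetP; exists p'; first by rewrite inE kp' tx'.
by rewrite /partner tx'.
Qed.

Lemma support_exists i p : kb i p -> i < d -> exists x, 0 < p.2 x.
Proof.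
case/and4P=> _ _ /eqP md _ id; have [x px|no] := pickP (fun y => 0 < p.2 y); first by exists x.
suff : mdeg (l * m) d p.2 = 0 by rewrite md; nlia.
by apply: big1 => y _; have := no y; case: (p.2 y : nat).
Qed.

Lemma toggle_none k i p : kb i p -> i < d -> toggle_vertex k p = None ->
  squarefree p /\ exists g, origin (multideg p) (cell_copy k p) = Some g /\
   forall s, ~~ toggleable (fun s => 0 < p.2 (turn s g)) (fun s => 0 < multideg p (turn s g)) m s.
Proof.
move=> kp id; have [x px] := support_exists kp id.
rewrite /toggle_vertex; case: pickP => // no.
rewrite (cell_copyE m1 k kp px); have [g og] := origin_exists (multideg p) x; rewrite og.
case: ltnP => // tm _; split; first by apply/forallP=> y; rewrite leqNgt no.
by exists g; split=> //; exact: first_toggle_none.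
Qed.

(* Every vertex [x] of the support is the centre of a block [x-1, x] or [x-1, x, x+1] of its copy
   of the cycle, and these disjoint blocks exhaust the multidegree inside that copy. *)
Definition star p :=
  [&& squarefree p,
    [forall x, (0 < p.2 x) ==> (turn m.-1 x \in p.1) && (p.2 (turn 2 x) == 0 :> nat)] &
    [forall x, forall y, [&& 0 < p.2 x, y \in p.1 & x %% l == y %% l] ==>
       (0 < p.2 (turn 1 y)) || (0 < p.2 (turn m.-1 y))]].

Lemma starP p : reflect
  [/\ forall x, multideg p x <= 1,
      forall x, 0 < p.2 x -> turn m.-1 x \in p.1 /\ p.2 (turn 2 x) = 0 :> nat &
      forall x y, 0 < p.2 x -> y \in p.1 -> x %% l = y %% l ->
        0 < p.2 (turn 1 y) \/ 0 < p.2 (turn m.-1 y)]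
  (star p).
Proof.
apply: (iffP and3P) => -[/forallP h1 h2 h3]; split=> //.
- by move=> x px; move/forallP: h2 => /(_ x); rewrite px => /andP[? /eqP].
- move=> x y px yp xy; move/forallP: h3 => /(_ x)/forallP/(_ y).
  by rewrite px yp xy eqxx => /orP.
- by apply/forallP=> x; apply/implyP=> /h2[-> ->].
- apply/forallP=> x; apply/forallP=> y; apply/implyP=> /and3P[px yp /eqP xy].
  by apply/orP; exact: h3 xy.
Qed.

Lemma support_copy i p g x k : kb i p -> origin (multideg p) (cell_copy k p) = Some g ->
  0 < p.2 x -> turn (relpos g x) g = x.
Proof.
move=> kp og px; apply: relposK.
by rewrite (origin_copy og) (cell_copyE m1 k kp px).
Qed.

Lemma multideg_gt0 p x : 0 < multideg p x -> 0 < p.2 x \/ x \in p.1.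
Proof. by rewrite /multideg; case: (x \in p.1); [right|rewrite addn0; left]. Qed.

(** Since the scan starts at a gap, a support vertex that cannot be toggled has its predecessor in
    [F] and no support vertex two places before. Applied two places further on, this also excludes
    [turn 2 x]. *)
Lemma critical_star k i p : kb i p -> i < d -> toggle_vertex k p = None ->
  (exists2 y : V, y %% l = cell_copy k p & multideg p y = 0) -> star p.
Proof.
move=> kp id tn [y yc y0]; have [sq [g [og nt]]] := toggle_none kp id tn.
have g0 : multideg p g = 0 := origin_gap og yc y0.
have pg0 : p.2 g = 0 :> nat by move: g0; rewrite /multideg; nlia.
have /and4P[_ _ _ /standard_joinP std] := kp.
have nt' s : 0 < s -> s < m -> 0 < multideg p (turn s g) ->
    p.2 (turn s.+1 g) = 0 :> nat -> p.2 (turn s.-1 g) = 0 :> nat ->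
    [/\ 1 < s, 0 < multideg p (turn s.-1 g) & p.2 (turn s.-2 g) = 0 :> nat].
  move=> s0 sm w u1 u2; have := nt s; rewrite /toggleable s0 sm w u1 u2 /=.
  rewrite !negb_or negbK => /and3P[h1 h2 h3]; split=> //; first by nlia.
  by apply/eqP; rewrite eqn0Ngt.
have nbr x : 0 < p.2 x -> p.2 (turn 1 x) = 0 :> nat /\ p.2 (turn m.-1 x) = 0 :> nat.
  move=> px; split; apply/eqP; rewrite eqn0Ngt; apply/negP=> h.
    by have [_ /eqP] := std m1 x (turn 1 x) px h.
  by have [_ /eqP[]] := std m1 (turn m.-1 x) x h px; rewrite turn_succK.
have supp s : s < m -> 0 < p.2 (turn s g) ->
    [/\ 1 < s, turn s.-1 g \in p.1 & p.2 (turn s.-2 g) = 0 :> nat].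
  move=> sm ps; have s0 : 0 < s by case: s ps {sm} => //; rewrite turn0 pg0.
  have [n1 n2] := nbr _ ps; rewrite turn_add addn1 in n1; rewrite turn_pred // in n2.
  have w : 0 < multideg p (turn s g) by rewrite /multideg ltn_addr.
  by have [h1 /multideg_gt0[|] h2 h3] := nt' s s0 sm w n1 n2; first by rewrite n2 in h2.
apply/starP; split=> [x|x px|x z px zp xz].
- exact: (forallP sq).
- have ex := support_copy kp og px; have sm := relpos_lt g x; move: px ex sm.
  set s := relpos g x => px ex sm; rewrite -ex in px *.
  have [h1 h2 h3] := supp s sm px; rewrite turn_pred; last by nlia.
  split=> //; rewrite turn_add; apply/eqP; rewrite eqn0Ngt; apply/negP=> h.
  (* Past the end, [s + 2] wraps to 0, which is the gap, or to 1, which [supp] excludes. *)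
  have [lt|] := ltnP (s + 2) m; first by have [_ _] := supp _ lt h; rewrite addn2 /=; nlia.
  move=> ms; have es : s + 2 = (s + 2 - m) + m by nlia.
  move: h; rewrite es turn_addm; have : s + 2 - m < 2 by nlia.
  case: (s + 2 - m) => [_|[_|//]]; first by rewrite turn0 pg0.
  by case/(supp _ m1).
- have zg : z %% l = g %% l by rewrite -xz (origin_copy og) (cell_copyE m1 k kp px).
  have ez := relposK zg; have sm := relpos_lt g z; move: ez sm; set s := relpos g z => ez sm.
  rewrite -ez; apply/orP; apply: contraT; rewrite negb_or -!eqn0Ngt => /andP[/eqP n1 /eqP n2].
  have zs : 0 < multideg p (turn s g) by rewrite ez /multideg zp addn1.
  (* A vertex of the multidegree that is neither in the support nor next to it, and cannot be
     toggled, has a predecessor in the same situation. The descent ends at position 0, which is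
     outside the multidegree. *)
  suff h b : b < m -> 0 < multideg p (turn b g) -> p.2 (turn b g) = 0 :> nat ->
      p.2 (turn b.+1 g) = 0 :> nat -> p.2 (turn b.-1 g) = 0 :> nat -> False.
    have s0 : 0 < s by case: s zs {ez sm n1 n2} => //; rewrite turn0 g0.
    rewrite turn_add addn1 in n1; rewrite turn_pred // in n2.
    case: (h s sm zs) => //; rewrite ez.
    by have := forallP sq z; rewrite /multideg zp addn1 ltnS leqn0 => /eqP.
  elim: b => [|b IH] bm w u0 u1 u2; first by rewrite turn0 g0 in w.
  have [b1 w' u3] := nt' b.+1 isT bm w u1 u2.
  exact: (IH (ltnW bm) w' u2 u0 u3).
Qed.

(** A support vertex has its predecessor in [F], hence not at the gap, and no support vertex two
    places before, so the last clause of [toggleable] fails. A vertex of [F] in this copy has a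
    neighbour in the support. *)
Lemma star_toggle_none k i p : kb i p -> i < d -> star p ->
  (exists2 y : V, y %% l = cell_copy k p & multideg p y = 0) -> toggle_vertex k p = None.
Proof.
move=> kp id /starP[sq st1 st2] [y yc y0]; case tx: toggle_vertex => [x|//].
case: (toggle_vertexP tx) => [[+ _]|[_ _ [g [og tm ex]]]]; first by rewrite ltnNge sq.
have g0 : multideg p g = 0 := origin_gap og yc y0.
have [t0 w u1 u2 h] := cell_toggleP tm; rewrite -ex in w.
move: (cell_toggle p g) t0 ex u1 u2 h {tm} => t t0 ex u1 u2 h.
case: (multideg_gt0 w) => [px|xp].
  have [xF x2] := st1 x px; rewrite ex turn_pred // in xF.
  case: h => [t1|h|h].
  - by move: xF; rewrite t1 turn0 => gF; move: g0; rewrite /multideg gF addn1.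
  - by move: h; rewrite /multideg xF addn1.
  - have [_] := st1 _ h; rewrite turn_add => h2.
    case: t t0 ex {xF u1 u2} h h2 => [//|[|t]] _ ex h h2.
      by move: h; rewrite turn0; move: g0; rewrite /multideg; case: (p.2 g : nat).
    by move: px; rewrite ex -[t.+2]addn2 h2.
have [z pz] := support_exists kp id.
have zx : z %% l = x %% l by rewrite ex turn_copy (origin_copy og) (cell_copyE m1 k kp pz).
case: (st2 z x pz xp zx); rewrite ex ?turn_pred // ?u2 //.
by rewrite turn_add addn1 u1.
Qed.

(** The supports agree by induction along the scan. If [t] is in one support, then [t.-1] is in its
    [F], hence in the multidegree and, by induction, in the other [F]. There it needs a support
    neighbour; [t.-2] is ruled out by the distance condition and the induction, which leaves [t]. *)
Lemma star_degree_unique i i' k p q : kb i p -> kb i' q -> i < d -> i' < d ->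
  star p -> star q -> multideg p =1 multideg q -> cell_copy k p = cell_copy k q ->
  (exists2 y : V, y %% l = cell_copy k p & multideg p y = 0) -> i = i'.
Proof.
move=> kp kq id id' stp stq mE cE [y yc y0].
have [g og] : exists g, origin (multideg p) (cell_copy k p) = Some g.
  by rewrite -yc; exact: origin_exists.
have g0 : multideg p g = 0 := origin_gap og yc y0.
have ogq : origin (multideg q) (cell_copy k q) = Some g.
  by rewrite -cE -og; apply: origin_ext => v; rewrite mE.
have step (p1 p2 : cell) j (kp2 : kb j p2) (jd : j < d) t : star p1 -> star p2 ->
    multideg p1 =1 multideg p2 -> multideg p1 g = 0 ->
    origin (multideg p2) (cell_copy k p2) = Some g ->
    (forall s, s < t -> (0 < p1.2 (turn s g)) = (0 < p2.2 (turn s g))) ->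
    0 < p1.2 (turn t g) -> 0 < p2.2 (turn t g).
  case/starP=> sq1 s1 s2 /starP[sq2 s1' s2'] mE' g0' og2 IH pt.
  have t0 : 0 < t by case: t pt {IH} => //; rewrite turn0; move: g0'; rewrite /multideg; case: (p1.2 g : nat).
  have [zF _] := s1 _ pt; rewrite turn_pred // in zF.
  have p1z : p1.2 (turn t.-1 g) = 0 :> nat.
    by have := sq1 (turn t.-1 g); rewrite /multideg zF addn1 ltnS leqn0 => /eqP.
  have zF2 : turn t.-1 g \in p2.1.
    have : 0 < multideg p2 (turn t.-1 g) by rewrite -mE' /multideg zF addn1.
    by case/multideg_gt0=> //; rewrite -IH ?p1z // prednK.
  have [w pw] := support_exists kp2 jd.
  have wz : w %% l = turn t.-1 g %% l by rewrite turn_copy (origin_copy og2) (cell_copyE m1 k kp2 pw).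
  case: (s2' w _ pw zF2 wz); rewrite turn_add ?addn1 ?prednK //.
  case: t t0 {IH} zF p1z zF2 wz pt (IH) => [//|[|t]] _ zF p1z zF2 wz pt IH.
    by move: zF; rewrite turn0 => gF; move: g0'; rewrite /multideg gF addn1.
  rewrite -turn_add turn_pred // -IH // => h; have [_] := s1 _ h.
  by rewrite turn_add addn2 /= => e; rewrite e in pt.
have agree t : (0 < p.2 (turn t g)) = (0 < q.2 (turn t g)).
  elim/ltn_ind: t => t IH; apply/idP/idP.
    exact: (step p q i' kq id').
  apply: (step q p i kp id) => //; first by rewrite -mE.
  by move=> s st; rewrite IH.
have supp x : (0 < p.2 x) = (0 < q.2 x).
  apply/idP/idP => px; first by rewrite -(support_copy kp og px) -agree (support_copy kp og px).
  by rewrite -(support_copy kq ogq px) agree (support_copy kq ogq px).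
have e x : p.2 x = q.2 x :> nat.
  have [sp _ _] := starP _ stp; have [sq _ _] := starP _ stq.
  have := supp x; have := sp x; have := sq x; rewrite /multideg.
  by move: (p.2 x : nat) (q.2 x : nat) => [|[|?]] [|[|?]].
have /and4P[_ _ /eqP mp _] := kp; have /and4P[_ _ /eqP mq _] := kq.
have : d - i = d - i' by rewrite -mp -mq; apply: eq_bigr.
by nlia.
Qed.

(** The first element is at 0 or 2 and each later one exactly 3 further. Each accounts for itself
    and the two positions after it: this is the invariant [part], with corrections at both ends. The
    closing condition [u m = u 0] excludes one start for [m] equal to 1 or 2 modulo 3, and the count
    is the same in every remaining case. *)
Lemma sum_toggle_none (u w : nat -> bool) : u m = u 0 ->
  (forall s, s < m -> u s -> ~~ u s.+1) -> (forall s, w s) ->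
  (forall s, ~~ toggleable u w m s) -> \sum_(s < m) u s = (m + 1) %/ 3.
Proof.
move=> um ind wT nt.
have nt' s : 0 < s -> s < m -> ~~ u s.+1 -> ~~ u s.-1 -> (s != 1) && ~~ u s.-2.
  by move=> s0 sm u1 u2; have := nt s; rewrite /toggleable s0 sm !wT u1 u2 /= negb_or.
have u1 : ~~ u 1.
  apply/negP=> h; have u0 : ~~ u 0 by apply: contraL h; exact: ind (ltnW m1).
  by have := nt' 1 isT m1 (ind 1 m1 h) u0.
have sep s : s.+2 < m -> u s.+2 -> ~~ u s.
  move=> sm h; have := nt' s.+2 isT sm (ind _ sm h); have := ind s.+1 (ltnW sm).
  by rewrite h /=; case: (u s.+1) => [/(_ isT)|_ /(_ isT)].
have dom s : 0 < s -> s < m -> [|| u s.-1, u s | u s.+1].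
  elim: s => // s IH _ sm; apply: contraT; rewrite !negb_or => /and3P[h1 h2 h3].
  have := nt' s.+1 isT sm h3 h1; case: s IH sm h1 h2 h3 => // s IH sm h1 h2 h3 /= h4.
  by have := IH isT (ltnW sm); rewrite (negPf h1) (negPf h2) (negPf h4).
(* Consecutive elements are at distance exactly 3, which determines all partial sums. *)
have part t : t.+2 <= m -> 3 * (\sum_(s < t.+2) u s) + 2 * ~~ u 0 = t.+2 + 2 * u t.+1 + u t.
  elim: t => [|t IH] tm; first by rewrite !big_ord_recr big_ord0 /= (negPf u1); case: (u 0).
  rewrite big_ord_recr /= mulnDr addnAC IH; last exact: ltnW.
  have := sep t tm; have := ind t.+1 (ltnW tm); have := ind t (ltnW (ltnW tm)).
  have := dom t.+1 isT (ltnW tm).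
  by clear; case: (u t); case: (u t.+1); case: (u t.+2) => //=; nlia.
have [t mt] : exists t, m = t.+2 by exists m.-2; nlia.
have tm : t.+1 < m by rewrite mt.
have h1 := ind t (ltnW tm); have h2 := ind t.+1 tm; have h3 := dom t.+1 isT tm.
rewrite -mt um /= in h2 h3; move: (part t (eq_leq (esym mt))); rewrite -mt.
move: (\sum_(s < m) u s) h1 h2 h3 => S.
by case: (u 0); case: (u t); case: (u t.+1) => //=; try (by move=> /(_ isT)); nlia.
Qed.

Lemma toggle_none_full k i p : kb i p -> i < d -> toggle_vertex k p = None ->
  (forall y : V, y %% l = cell_copy k p -> 0 < multideg p y) -> d - i = (m + 1) %/ 3.
Proof.
move=> kp id tn full; have [/forallP sq [g [og nt]]] := toggle_none kp id tn.
have /and4P[_ _ /eqP <- /standard_joinP std] := kp.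
rewrite -(sum_toggle_none (u := fun s => 0 < p.2 (turn s g)) _ _ _ nt); last 1 first.
- by move=> s; apply: full; rewrite turn_copy (origin_copy og).
- rewrite /mdeg (bigID (fun v : V => v %% l == g %% l)) /= addnC big1 ?add0n.
    rewrite (reindex_onto (fun s : 'I_m => turn s g) (fun v => Ordinal (relpos_lt g v))) /=; last first.
      by move=> v /eqP vg; rewrite relposK.
    apply: eq_big => s.
      by rewrite turn_copy eqxx /= -val_eqE /= relpos_turn ?eqxx.
    by move=> _; have := sq (turn s g); rewrite /multideg; case: (p.2 _ : nat) => [|[]].
  move=> v vg; apply/eqP; rewrite eqn0Ngt; apply: contra vg => pv.
  by rewrite (origin_copy og) (cell_copyE m1 k kp pv).
- by rewrite turnm turn0.
- move=> s sm ps; apply/negP=> ps'; have [_ /eqP[]] := std m1 _ _ ps ps'.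
  by rewrite turn_add addn1.
Qed.

End Critical.

(** * Betti numbers and critical cells *)

Section Betti.
Context {K : fieldType} {l m : nat} (m1 : 1 < m).
Local Notation V := 'I_(l * m).
Local Notation E := (circulant_adj (l * m) (join_S l m)).
Local Notation cell d := (kindex (l * m) d).
Local Notation stdE d := (standard (l * m) d E).
Local Notation kb d := (kbasis (l * m) E d).
Local Notation kent d := (@kentry K (l * m) E d).
Local Notation betti := (betti K (l * m) E).
Implicit Types (x y v g : V) (i k s t r d : nat).

Lemma cell_copy_default k k' d i (p : cell d) : kb d i p -> i < d -> cell_copy k p = cell_copy k' p.
Proof.
move=> kp id; have [x px] := support_exists m1 kp id.
by rewrite (cell_copyE m1 k kp px) (cell_copyE m1 k' kp px).
Qed.

Lemma toggle_default k k' d i (p : cell d) : kb d i p -> i < d ->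
  toggle_vertex k p = toggle_vertex k' p.
Proof. by move=> kp id; rewrite /toggle_vertex (cell_copy_default k k' kp id). Qed.

(** A weak Morse inequality: matched cells of degree [i] count towards one rank, partners of those
    of degree [i.+1] towards the other. *)
Lemma betti_le_critical i d : i.+1 < d ->
  betti i d <= #|[set p : cell d | kb d i p & toggle_vertex 0 p == None]|.
Proof.
move=> id; rewrite bettiE.
have r1 := rank_triangular (acyclic_matched (K := K) (l := l) m1 (d := d) 0 i).
have r2 := rank_triangular (acyclic_matched (K := K) (l := l) m1 (d := d) 0 i.+1).
set Z := [set p | _ & toggle_vertex 0 p == None]; rewrite -subnDA leq_subLR.
have sub : [set p : cell d | kb d i p] \subset
    matched 0 i :|: partner 0 @: matched 0 i.+1 :|: Z.
  apply/subsetP=> p; rewrite inE => kp; rewrite 2!in_setU.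
  have -> : (p \in Z) = (toggle_vertex 0 p == None) by rewrite inE kp.
  case tp: (toggle_vertex 0 p) => [x|]; last by rewrite orbT.
  case: (boolP (x \in p.1)) => xp; first by rewrite inE kp tp xp.
  by rewrite (partner_cover m1 kp tp xp) ?orbT //; left.
apply: leq_trans (subset_leq_card sub) _; apply: leq_trans (leq_card_setU _ _) _.
rewrite leq_add2r; apply: leq_trans (leq_card_setU _ _) _; apply: leq_add => //.
exact: leq_trans (leq_imset_card _ _) r2.
Qed.

(** The cells of [Z] are cycles because no variable of [F] can be moved. In their blocks every cell
    of degree [i.+1] is matched, so by [morse_image0] no nonzero boundary is supported on [Z]. *)
Lemma betti_ge_isolated i d (Z : {set cell d}) : i.+1 < d ->
  (forall c, c \in Z -> kb d i c) ->
  (forall c j, c \in Z -> j \in c.1 -> ~~ stdE d (up c j).2) ->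
  (forall c, c \in Z -> toggle_vertex 0 c = None) ->
  (forall c q, c \in Z -> kb d i.+1 q -> multideg q =1 multideg c ->
     cell_copy 0 q = cell_copy 0 c -> toggle_vertex 0 q != None) ->
  #|Z| <= betti i d.
Proof.
move=> id Zk Zmax Zt Zq; rewrite bettiE.
suff : \rank (fmx (kent d i.+1)) + #|Z| + \rank (fmx (kent d i)) <= #|[set p : cell d | kb d i p]|.
  by rewrite -subnDA => h; rewrite leq_subRL; nlia.
apply: homology_rank_lower.
- exact: koszul_complex.
- by move=> p q /kentry_neq0[kp _]; rewrite inE.
- by move=> p q /kentry_kbasis kq; rewrite inE.
- by apply/subsetP=> c /Zk kc; rewrite inE.
- move=> c q cZ; apply/eqP; apply: contraT => /kentry_neq0[_ [j jc [-> st]]].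
  by rewrite (negPf (Zmax c j cZ jc)) in st.
move=> y y0 c cZ; have kc := Zk c cZ; have id' := ltnW id.
(* If [d = i.+2], cells of degree [i.+2] have constant monomials; this default places them in the
   copy of [c]. *)
pose k := cell_copy 0 c.
pose B := [set p : cell d | [forall v, multideg p v == multideg c v] & cell_copy k p == k].
apply: (morse_image0 (koszul_complex E i.+1) (acyclic_matched m1 k i.+2)
          (acyclic_matched m1 k i.+1) (B := B)).
- move=> p q pq; have mE := kentry_multideg pq; have kq := kentry_kbasis pq.
  case/kentry_neq0: pq => kp [j jp [eq _]]; have [x px] := support_exists m1 kp id.
  have qx : 0 < q.2 x by rewrite eq (up_expo kp jp) ltn_addr.
  rewrite !inE (cell_copyE m1 k kp px) (cell_copyE m1 k kq qx); congr andb.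
  by apply: eq_forallb => v; rewrite mE.
- move=> p q; rewrite inE => /andP[/forallP mE /eqP cp] /kentry_neq0[kp _].
  have tne : toggle_vertex k p != None.
    rewrite (toggle_default k 0 kp id); apply: (Zq c) => //; first by move=> v; apply/eqP.
    by rewrite (cell_copy_default 0 k kp id) cp.
  case tx: (toggle_vertex k p) tne => [x|//] _.
  case: (boolP (x \in p.1)) => xp; first by left; rewrite inE kp tx.
  by right; apply: (partner_cover m1 kp tx xp); right.
(* A partner keeps its toggle vertex while cells of [Z] have none, so the columns of the matching
   avoid [Z]. *)
- move=> q qm; apply: y0; apply/negP=> /[dup] qZ /Zk kq.
  have := partner_toggle m1 qm; rewrite (toggle_default k 0 kq id') Zt //.
  by move: qm; rewrite inE => /andP[_]; case: toggle_vertex.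
- by rewrite inE -/k (cell_copy_default k 0 kc id') eqxx andbT; apply/forallP.
Qed.

Definition has_gap d (p : cell d) :=
  [exists y : V, (y %% l == cell_copy 0 p) && (multideg p y == 0)].

Lemma has_gapP d (p : cell d) :
  reflect (exists2 y : V, y %% l = cell_copy 0 p & multideg p y = 0) (has_gap p).
Proof.
apply: (iffP existsP) => -[y]; first by case/andP=> /eqP ? /eqP ?; exists y.
by move=> yc y0; exists y; rewrite yc y0 !eqxx.
Qed.

Lemma betti_ge_star i d : i.+1 < d ->
  #|[set p : cell d | [&& kb d i p, star p & has_gap p]]| <= betti i d.
Proof.
move=> id; have id' := ltnW id; apply: betti_ge_isolated => // c.
- by rewrite inE => /andP[].
- move=> j; rewrite inE => /and3P[kc /starP[_ _ sc] _] jc.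
  have [x cx] := support_exists m1 kc id'.
  apply/negP=> /(standard_joinP m1) st.
  have uj : 0 < (up c j).2 j by rewrite (up_expo kc jc) eqxx addn1.
  have uc z : 0 < c.2 z -> 0 < (up c j).2 z by move=> cz; rewrite (up_expo kc jc) ltn_addr.
  have [xj _] := st x j (uc _ cx) uj.
  case: (sc x j cx jc xj) => /uc h; first by have [_ /eqP] := st _ _ uj h.
  by have [_ /eqP[]] := st _ _ h uj; rewrite turn_succK.
- by rewrite inE => /and3P[kc sc /has_gapP gc]; exact: (star_toggle_none m1 kc).
move=> q; rewrite inE => /and3P[kc sc /has_gapP gc] kq mE cE; apply/eqP=> tq.
have gq : exists2 y : V, y %% l = cell_copy 0 q & multideg q y = 0.
  by case: gc => y yc y0; exists y; rewrite ?cE ?mE.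
have sq := critical_star m1 kq id tq gq.
by have := star_degree_unique m1 kq kc id id' sq sc mE cE gq; nlia.
Qed.

Definition support d (p : cell d) : {set V} := [set x | 0 < p.2 x].

Lemma card_support d i (p : cell d) : kb d i p -> squarefree p -> #|support p| = d - i.
Proof.
case/and4P=> _ _ /eqP <- _ /forallP sq; rewrite /mdeg -sum1_card big_mkcond /=.
apply: eq_bigr => x _; have := sq x; rewrite /multideg inE.
by case: (p.2 x : nat) => [|[]].
Qed.

Lemma turn_injective s : injective (turn s : V -> V).
Proof.
move=> x y e; have e' : turn (m - s %% m) (turn s x) = turn (m - s %% m) (turn s y) by rewrite e.
move: e'; rewrite !turn_add; have m0 := gt0_m x.
have -> : s + (m - s %% m) = (s %/ m).+1 * m.
  rewrite {1}(divn_eq s m) -addnA subnKC; last by rewrite ltnW // ltn_pmod.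
  by rewrite mulSn addnC.
elim: (s %/ m) => [|a IH]; first by rewrite mul1n !turnm.
by rewrite mulSn addnC !turn_addm.
Qed.

Definition copy_of x : {set V} := [set y : V | y %% l == x %% l].

Lemma card_copy x : #|copy_of x| = m.
Proof.
rewrite -[RHS]card_ord -(@card_imset _ _ (fun s : 'I_m => turn s x)).
  apply: eq_card => y; rewrite inE; apply/eqP/imsetP => [yx|[s _ ->]]; last exact: turn_copy.
  by exists (Ordinal (relpos_lt x y)); rewrite //= relposK.
by move=> s t /(turn_inj (ltn_ord s) (ltn_ord t)) /val_inj.
Qed.

(** The bound holds because [U] and its shifts by one step either way are disjoint in the copy:
    predecessors lie in [F] and the multidegree is squarefree, successors are excluded by
    independence, and the two shifts meet only if two support vertices are two steps apart. *)
Lemma star_copy d i (p : cell d) x : kb d i p -> star p -> x \in support p ->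
  let U := support p in
  [set y in copy_of x | 0 < multideg p y] \subset U :|: turn m.-1 @: U :|: turn 1 @: U /\
  3 * (d - i) <= m.
Proof.
move=> kp sp; rewrite inE => px U; have /and3P[sq _ _] := sp; have /starP[_ s1 s2] := sp.
split.
  apply/subsetP=> y; rewrite 2!inE => /andP[/eqP yx /multideg_gt0[py|yp]].
    by rewrite !in_setU inE py.
  have [h|h] := s2 x y px yp (esym yx).
    have : turn m.-1 (turn 1 y) \in turn m.-1 @: U by rewrite imset_f // inE.
    by rewrite turn_predK !in_setU => ->; rewrite orbT.
  have : turn 1 (turn m.-1 y) \in turn 1 @: U by rewrite imset_f // inE.
  by rewrite turn_succK !in_setU => ->; rewrite orbT.
have UP y : y \in U -> y \notin turn m.-1 @: U.
  move=> yU; apply/imsetP=> -[z]; rewrite inE => pz e; have [zF _] := s1 z pz.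
  move: yU; rewrite e inE; have := forallP sq (turn m.-1 z); rewrite /multideg zF.
  by rewrite addn1 ltnS leqn0 => /eqP->.
have UN y : y \in U -> y \notin turn 1 @: U.
  move=> yU; apply/imsetP=> -[z]; rewrite inE => pz e; have /and4P[_ _ _ /(standard_joinP m1) st] := kp.
  by move: yU; rewrite inE => py; have [_ /eqP] := st z y pz py.
have PN y : y \in turn m.-1 @: U -> y \notin turn 1 @: U.
  move=> /imsetP[z]; rewrite inE => pz ->; apply/imsetP=> -[z']; rewrite inE => pz' e.
  have [_] := s1 z' pz'; rewrite (_ : turn 2 z' = z); first by move=> e'; rewrite e' in pz.
  by rewrite -[z]turn_succK e turn_add.
have dUPN : #|U :|: turn m.-1 @: U :|: turn 1 @: U| = 3 * (d - i).
  have d1 : U :&: turn m.-1 @: U = set0.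
    by apply/setP=> y; rewrite in_setI in_set0; apply/andP=> -[/UP /negPf h]; rewrite h.
  have d2 : (U :|: turn m.-1 @: U) :&: turn 1 @: U = set0.
    apply/setP=> y; rewrite in_setI in_setU in_set0.
    by apply/andP=> -[/orP[/UN|/PN] /negPf h]; rewrite h.
  rewrite cardsU d2 cards0 subn0 cardsU d1 cards0 subn0.
  by rewrite !card_imset ?(card_support kp) //; [nlia|exact: turn_injective..].
have UC y : y \in U -> y \in copy_of x.
  by rewrite !inE => py; rewrite -(cell_copyE m1 0 kp px) (cell_copyE m1 0 kp py).
rewrite -dUPN; apply: leq_trans (_ : _ <= #|copy_of x|) _; last by rewrite card_copy.
apply: subset_leq_card; apply/subsetP=> y.
rewrite !in_setU -orbA => /or3P[/UC//|/imsetP[z /UC zx ->]|/imsetP[z /UC zx ->]];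
  by move: zx; rewrite !inE turn_copy.
Qed.

Lemma star_gap d i (p : cell d) : kb d i p -> i < d -> star p -> 3 * (d - i) < m -> has_gap p.
Proof.
move=> kp id sp lt; have [x px] := support_exists m1 kp id.
have xU : x \in support p by rewrite inE.
have [sub _] := star_copy kp sp xU; have /and3P[sq _ _] := sp.
apply/has_gapP; rewrite (cell_copyE m1 0 kp px).
have [y /andP[/eqP yx /eqP y0]|full] := pickP (fun y : V => (y %% l == x %% l) && (multideg p y == 0)).
  by exists y.
suff : m <= 3 * (d - i) by rewrite leqNgt lt.
rewrite -{1}(card_copy x); apply: leq_trans (_ : #|[set y in copy_of x | 0 < multideg p y]| <= _).
  apply: subset_leq_card; apply/subsetP=> y; rewrite !inE => yx.
  by have := full y; rewrite yx /= lt0n => ->.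
apply: leq_trans (subset_leq_card sub) _.
have -> : 3 * (d - i) = #|support p| + #|turn m.-1 @: support p| + #|turn 1 @: support p|.
  by rewrite !card_imset ?(card_support kp) //; [nlia|exact: turn_injective..].
by apply: leq_trans (leq_card_setU _ _) _; rewrite leq_add2r leq_card_setU.
Qed.

Lemma critical_starE d i (p : cell d) : kb d i p -> i < d -> d - i != (m + 1) %/ 3 ->
  toggle_vertex 0 p = None -> star p.
Proof.
move=> kp id ne tp; have [/has_gapP gp|/has_gapP ng] := boolP (has_gap p).
  exact: (critical_star m1 kp id tp gp).
case/eqP: ne; apply: (toggle_none_full m1 kp id tp) => y yc.
by rewrite lt0n; apply/eqP => y0; apply: ng; exists y.
Qed.

Lemma betti_small i d : i.+1 < d -> d - i < (m + 1) %/ 3 ->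
  betti i d = #|[set p : cell d | kb d i p & star p]|.
Proof.
move=> id lt; have id' := ltnW id; apply/eqP; rewrite eqn_leq; apply/andP; split.
  apply: leq_trans (betti_le_critical id) _; apply: subset_leq_card; apply/subsetP=> p.
  rewrite !inE => /andP[kp /eqP tp]; rewrite kp (critical_starE kp) //.
  by rewrite neq_ltn lt.
apply: leq_trans (betti_ge_star id); apply: subset_leq_card; apply/subsetP=> p.
rewrite !inE => /andP[kp sp]; rewrite kp sp (star_gap kp) //.
by move: lt; clear; nlia.
Qed.

Lemma betti_large i d : 4 < m -> i + (m + 1) %/ 3 < d -> betti i d = 0.
Proof.
move=> m5 lt; have id : i.+1 < d by nlia.
apply/eqP; rewrite -leqn0; apply: leq_trans (betti_le_critical id) _.
rewrite leqn0 cards_eq0; apply/eqP/setP=> p; rewrite in_set0 inE; apply/andP=> -[kp /eqP tp].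
have sp : star p by apply: (critical_starE kp _ _ tp); nlia.
have [x px] := support_exists m1 kp (ltnW id).
have xU : x \in support p by rewrite inE.
by have [_] := star_copy kp sp xU; nlia.
Qed.

End Betti.

(** * Non-vanishing in the top degree *)

Section Top.
Context {K : fieldType} {l m : nat} (m1 : 1 < m).
Local Notation V := 'I_(l * m).
Local Notation E := (circulant_adj (l * m) (join_S l m)).
Local Notation cell d := (kindex (l * m) d).
Local Notation stdE d := (standard (l * m) d E).
Local Notation kb d := (kbasis (l * m) E d).
Local Notation betti := (betti K (l * m) E).
Implicit Types (x y v g : V) (i k s t r d : nat) (F U : {set V}).

Definition sqcell d F U : cell d := (F, [ffun v => inord (v \in U)]).

Lemma sqcell_expo d F U v : 0 < d -> (sqcell d F U).2 v = (v \in U) :> nat.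
Proof. by move=> d0; rewrite ffunE inordK // ltnS (leq_trans (leq_b1 _)). Qed.

Lemma support_sqcell d F U : 0 < d -> support (sqcell d F U) = U.
Proof. by move=> d0; apply/setP=> v; rewrite inE sqcell_expo // lt0b. Qed.

Lemma kbasis_sqcell d i F U : 0 < d -> i <= d -> #|F| = i -> #|U| = d - i ->
  (forall x y, x \in U -> y \in U -> x %% l = y %% l /\ y != turn 1 x) ->
  kb d i (sqcell d F U).
Proof.
move=> d0 id Fi Ui st; apply/and4P; split=> //; first by rewrite Fi.
  rewrite /mdeg (eq_bigr (fun v => (v \in U) : nat)) => [|v _]; last by rewrite sqcell_expo.
  by rewrite -Ui -sum1_card [X in _ == X]big_mkcond.
by apply/(standard_joinP m1) => x y; rewrite !sqcell_expo // !lt0b; exact: st.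
Qed.

Lemma multideg_sqcell d F U v : 0 < d -> multideg (sqcell d F U) v = (v \in U) + (v \in F).
Proof. by move=> d0; rewrite /multideg sqcell_expo. Qed.

Section Steps.
Context (g : V) (c K0 : nat).
Context (cK : 3 * K0 <= m + 2 - c).
Context (c3 : c < 3).

(** The bound [cK] is what keeps the last position [3 * (K0 - 1) + c] below [m]. *)
Definition steps : {set V} := [set turn (3 * j + c) g | j : 'I_K0].

Lemma steps_lt (j : 'I_K0) : 3 * j + c < m.
Proof. by have := ltn_ord j; move: (j : nat) => a; nlia. Qed.

Lemma mem_steps s : s < m -> (turn s g \in steps) = (s %% 3 == c) && (s < 3 * K0).
Proof.
move=> sm; apply/imsetP/andP => [[j _ /(turn_inj sm (steps_lt j)) ->]|[/eqP sc sK]].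
  by split; have := ltn_ord j; move: (j : nat) => a; nlia.
have jK : s %/ 3 < K0 by nlia.
by exists (Ordinal jK) => //; congr turn; rewrite /=; nlia.
Qed.

Lemma card_steps : #|steps| = K0.
Proof.
rewrite card_imset ?card_ord // => i j /(turn_inj (steps_lt i) (steps_lt j)) e.
by apply/val_inj/eqP; move/eqP: e; rewrite eqn_add2r eqn_pmul2l.
Qed.

Lemma steps_copy x : x \in steps -> x %% l = g %% l.
Proof. by case/imsetP=> j _ ->; rewrite turn_copy. Qed.

Lemma stepsE x : x \in steps -> exists s, [/\ x = turn s g, s < m & (s %% 3 == c) && (s < 3 * K0)].
Proof.
move=> xs; have xg := relposK (steps_copy xs); exists (relpos g x).
by rewrite xg relpos_lt -mem_steps ?relpos_lt // xg.
Qed.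

End Steps.

(** The witness is a star made of [k] blocks of two vertices, at positions 0 and 1 modulo 3;
    position 2 is a gap. *)
Lemma betti_top_big (v0 : V) k : 4 < m -> 1 < k -> 3 * k <= m -> betti k (k + k) != 0.
Proof.
move=> m5 k1 km; have d0 : 0 < k + k by nlia.
rewrite -lt0n; apply: leq_trans (betti_ge_star (K := K) (l := l) m1 _); last by nlia.
have c1 : 3 * k <= m + 2 - 1 by nlia.
have c0 : 3 * k <= m + 2 - 0 by nlia.
pose U := steps v0 1 k; pose F := steps v0 0 k.
have uE := mem_steps v0 c1 isT; have fE := mem_steps v0 c0 isT.
have uS := stepsE (g := v0) c1 isT; have fS := stepsE (g := v0) c0 isT.
pose p := sqcell (k + k) F U.
have kp : kb (k + k) k p.
  apply: kbasis_sqcell; rewrite ?card_steps //; try by nlia.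
  move=> x y xU yU; split; first by rewrite (steps_copy xU) (steps_copy yU).
  have [s [-> sm /andP[s3 sk]]] := uS x xU; apply: contraTneq yU => ->.
  rewrite turn_add addn1; have sm' : s.+1 < m by nlia.
  by rewrite uE //; nlia.
have sp : star p.
  apply/starP; split=> [x|x|x y].
  - rewrite multideg_sqcell //; case: (boolP (x \in U)) => [/uS[s [-> sm h]]|_]; last exact: leq_b1.
    by rewrite fE //; nlia.
  - rewrite !sqcell_expo // lt0b => /uS[s [-> sm h]]; rewrite turn_pred; last by nlia.
    rewrite fE; last by nlia.
    split; first by nlia.
    rewrite turn_add; have [lt|ge] := ltnP (s + 2) m; first by rewrite uE //; nlia.
    have -> : s + 2 = 0 + m by nlia.
    by rewrite turn_addm uE //; nlia.
  - move=> _ /fS[s [-> sm h]] _; left; rewrite sqcell_expo // lt0b turn_add addn1 uE; nlia.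
apply/card_gt0P; exists p; rewrite inE kp sp; apply/has_gapP; exists (turn 2 v0).
  have [x px] := support_exists m1 kp (ltac:(nlia)).
  rewrite (cell_copyE m1 0 kp px) turn_copy (steps_copy (x := x) (g := v0) (c := 1) (K0 := k)) //.
  by move: px; rewrite sqcell_expo // lt0b.
by rewrite multideg_sqcell // uE ?fE //; nlia.
Qed.

(** Here [m = 3 * k - 1] is too short for a star with [k] support vertices. The witness fills a
    whole copy, with support at the multiples of 3; every other vertex is next to the support,
    [m - 1] being next to 0. It is isolated because [toggle_none_full] allows unmatched cells of a
    full block in one degree only. *)
Lemma betti_top_full (v0 : V) k : 4 < m -> 3 * k = m + 1 -> betti (m - k) m != 0.
Proof.
move=> m5 km; have d0 : 0 < m by nlia.
pose k0 := v0 %% l.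
(* In a full copy [origin] falls back on this [pick], and the support has to start where the scan
   does. *)
have [g og] : exists g : V, [pick g : V | g %% l == k0] = Some g.
  by case: pickP => [g _|/(_ v0)]; [exists g|rewrite eqxx].
have c0 : 3 * k <= m + 2 - 0 by nlia.
pose U := steps g 0 k; pose F := copy_of g :\: U.
have uE s : s < m -> (turn s g \in U) = (s %% 3 == 0).
  by move=> sm; rewrite (mem_steps g c0) // andb_idr // => _; nlia.
have uS := stepsE (g := g) c0 isT.
have UC : U \subset copy_of g by apply/subsetP=> x /steps_copy xg; rewrite inE xg.
pose p := sqcell m F U.
have kp : kb m (m - k) p.
  apply: kbasis_sqcell; rewrite ?card_steps //; try by nlia.
    by rewrite cardsD (setIidPr UC) card_copy card_steps.
  move=> x y xU yU; split; first by rewrite (steps_copy xU) (steps_copy yU).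
  have [s [-> sm /andP[s3 sk]]] := uS x xU; apply: contraTneq yU => ->.
  rewrite turn_add addn1; have sm' : s.+1 < m by nlia.
  by rewrite uE //; nlia.
have gU : g \in U by rewrite -[g]turn0 uE.
have pg : 0 < p.2 g by rewrite sqcell_expo // gU.
have mE v : multideg p v = (v %% l == g %% l).
  rewrite multideg_sqcell // !inE; case: (boolP (v \in U)) => //.
  by move=> /steps_copy->; rewrite eqxx.
have uP s : s <= m -> s %% 3 = 0 \/ s = m -> 0 < p.2 (turn s g).
  rewrite leq_eqVlt sqcell_expo // lt0b => /orP[/eqP-> _|sm [s3|sm']]; first by rewrite turnm.
    by rewrite uE // s3.
  by rewrite sm' ltnn in sm.
have gk : g %% l = k0 by move: og; case: pickP => // y /eqP yk [<-].
rewrite -lt0n; have id : (m - k).+1 < m by nlia.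
apply: leq_trans (@betti_ge_isolated K l m m1 (m - k) m [set p] id _ _ _ _).
- by rewrite cards1.
- by move=> c; rewrite inE => /eqP->.
- move=> c j; rewrite inE => /eqP-> jF; apply/negP=> /(standard_joinP m1) st.
  move: (jF); rewrite !inE => /andP[jU /eqP jg].
  have ej := relposK jg; have sm := relpos_lt g j; move: (relpos g j) ej sm => s ej sm.
  have uj : 0 < (up p j).2 j by rewrite (up_expo kp jF) eqxx addn1.
  have uc z : 0 < p.2 z -> 0 < (up p j).2 z by move=> cz; rewrite (up_expo kp jF) ltn_addr.
  rewrite -ej uE // in jU.
  have [s1|s2] : s %% 3 = 1 \/ s %% 3 = 2 by nlia.
    have h : 0 < p.2 (turn s.-1 g) by apply: uP; [nlia|left; nlia].
    have [_ /eqP[]] := st _ _ (uc _ h) uj; rewrite turn_add -ej; congr turn; nlia.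
  have h : 0 < p.2 (turn s.+1 g) by apply: uP; [nlia|left; nlia].
  by have [_ /eqP[]] := st _ _ uj (uc _ h); rewrite -ej turn_add addn1.
- move=> c; rewrite inE => /eqP->; case tx: toggle_vertex => [x|//].
  case: (toggle_vertexP tx) => [[+ _]|[_ _ [g' [og' tm _]]]].
    by rewrite mE; case: (_ == _).
  have ek := cell_copyE m1 0 kp pg.
  have eg : g' = g.
    move: og'; rewrite ek /origin; case: pickP => [y /andP[/eqP yg]|_]; first by rewrite mE yg eqxx.
    by rewrite gk og => -[].
  have [t0 _ u1 u2 h] := cell_toggleP tm; rewrite eg in u1 u2 h tm t0.
  move: (cell_toggle p g) tm t0 u1 u2 h => t tm t0 u1 u2 h.
  have nz s : p.2 (turn s g) = 0 :> nat -> s <= m -> s %% 3 <> 0 /\ s <> m.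
    move=> e sm; have h' := uP s sm; split=> e'; suff : 0 < p.2 (turn s g) by rewrite e.
      by apply: h'; left.
    by apply: h'; right.
  have [a1 a2] := nz _ u1 tm; have [b1 b2] := nz _ u2 (leq_trans (leq_pred _) (ltnW tm)).
  have t3 : t %% 3 = 0 by clear -a1 b1 t0; lia.
  case: h => [t1|h|h].
  + by rewrite t1 in t3.
  + by move: h; rewrite mE turn_copy eqxx.
  + by move: h; rewrite sqcell_expo // lt0b uE; nlia.
move=> c q; rewrite inE => /eqP-> kq mq cq; apply/eqP=> tq.
have := toggle_none_full m1 kq id tq; rewrite cq (cell_copyE m1 0 kp pg).
have full y : y %% l = g %% l -> 0 < multideg q y by rewrite mq mE => ->; rewrite eqxx.
by move/(_ full); nlia.
Qed.

Lemma betti_top (v0 : V) : 4 < m -> exists i, betti i (i + (m + 1) %/ 3) != 0.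
Proof.
move=> m5; set k := (m + 1) %/ 3.
have [le|gt] := leqP (3 * k) m.
  by exists k; apply: betti_top_big => //; rewrite /k; nlia.
have km : 3 * k = m + 1 by rewrite /k in gt *; nlia.
by exists (m - k); rewrite subnK; [exact: betti_top_full|nlia].
Qed.

End Top.

(** * Counting stars *)

Section Count.
Context {l m : nat} (m1 : 1 < m).
Local Notation V := 'I_(l * m).
Local Notation E := (circulant_adj (l * m) (join_S l m)).
Local Notation cell d := (kindex (l * m) d).
Local Notation kb d := (kbasis (l * m) E d).
Implicit Types (x y v g : V) (i k s t r d : nat) (F G U : {set V}).

Definition separated U :=
  [forall x in U, forall y in U, [&& x %% l == y %% l, y != turn 1 x & y != turn 2 x]].

Lemma separatedP U : reflect
  (forall x y, x \in U -> y \in U -> [/\ x %% l = y %% l, y != turn 1 x & y != turn 2 x])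
  (separated U).
Proof.
apply: (iffP forall_inP) => h x; last first.
  by move=> xU; apply/forall_inP=> y yU; have [-> -> ->] := h x y xU yU; rewrite eqxx.
by move=> y /h/forall_inP h' /h' /and3P[/eqP].
Qed.

Lemma star_separated d i (p : cell d) : kb d i p -> star p -> separated (support p).
Proof.
move=> /and4P[_ _ _ /(standard_joinP m1) st] /starP[_ s1 _].
apply/separatedP=> x y; rewrite !inE => px py; have [e1 e2] := st x y px py; split=> //.
by have [_ h] := s1 x px; apply: contraTneq py => ->; rewrite h.
Qed.

Section Fibre.
Context (U : {set V}) (x : V).
Context (sepU : separated U) (xU : x \in U).

Let P := turn m.-1 @: U.
Let X := ~: copy_of x :|: turn 1 @: U.

Let sep y z : y \in U -> z \in U -> [/\ y %% l = z %% l, z != turn 1 y & z != turn 2 y].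
Proof. exact: (separatedP _ sepU). Qed.

Let U_copy y : y \in U -> y \in copy_of x.
Proof. by move=> yU; rewrite inE; have [->] := sep xU yU. Qed.

Let UP y : y \in U -> y \notin P.
Proof.
move=> yU; apply/imsetP=> -[z zU e]; have [_ /eqP[]] := sep yU zU.
by rewrite e turn_succK.
Qed.

Let UX y : y \in U -> y \notin X.
Proof.
move=> yU; rewrite !in_setU in_setC U_copy //=; apply/imsetP=> -[z zU e].
by have [_ /eqP[]] := sep zU yU.
Qed.

Let PX y : y \in P -> y \notin X.
Proof.
case/imsetP=> z zU ->; rewrite in_setU in_setC negb_or negbK inE turn_copy.
have := U_copy zU; rewrite inE => -> /=; apply/imsetP=> -[w wU e].
by have [_ _ /eqP[]] := sep wU zU; rewrite -[z]turn_succK e turn_add.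
Qed.

(** Given [U], the set [F] consists of the forced predecessors [P] and an arbitrary subset of [X],
    which is made of the other copies and the successors of [U]. The test [d - i <= i] guards
    against the truncation of [i - (d - i)] to 0. *)
Lemma card_star_fibre d i : i < d -> #|U| = d - i ->
  #|[set p : cell d | [&& kb d i p, star p & support p == U]]| =
  if d - i <= i then 'C((l - 1) * m + (d - i), i - (d - i)) else 0.
Proof.
move=> id cU; have d0 : 0 < d by apply: leq_ltn_trans id.
have cP : #|P| = d - i by rewrite card_imset //; exact: turn_injective.
have cX : #|X| = (l - 1) * m + (d - i).
  rewrite cardsU [X in _ - #|pred_of_set X|](_ : _ = set0) ?cards0 ?subn0.
    rewrite card_imset ?cU; last exact: turn_injective.
    by congr (_ + _); rewrite cardsCs setCK card_ord card_copy mulnBl mul1n.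
  apply/setP=> y; rewrite in_setI in_set0 in_setC; apply/andP=> -[yc /imsetP[z /U_copy zU ey]].
  by case/negP: yc; rewrite inE ey turn_copy; rewrite inE in zU.
set S := [set p | _]; pose f G : cell d := sqcell d (P :|: G) U.
have Sf p : p \in S -> [/\ d - i <= i, p.1 :\: P \subset X, #|p.1 :\: P| = i - (d - i) & p = f (p.1 :\: P)].
  rewrite inE => /and3P[kp /starP[sq s1 s2] /eqP sU].
  have suppE y : (0 < p.2 y) = (y \in U) by rewrite -sU inE.
  have PF : P \subset p.1.
    by apply/subsetP=> y /imsetP[z]; rewrite -suppE => /s1[zF _] ->.
  have /and4P[/eqP ci _ _ _] := kp.
  have cD : #|p.1 :\: P| = i - (d - i) by rewrite cardsD (setIidPr PF) ci cP.
  split=> //; first by rewrite -{2}ci -cP subset_leq_card.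
    apply/subsetP=> y; rewrite !in_setU in_setC inE => /andP[yP yF].
    have [/=|//] := boolP (y \in copy_of x); rewrite inE => /eqP yx.
    have px : 0 < p.2 x by rewrite suppE.
    have [h|h] := s2 x y px yF (esym yx).
      case/negP: yP; rewrite -[y]turn_predK; apply: imset_f.
      by rewrite -suppE.
    by rewrite -[y]turn_succK imset_f // -suppE.
  have -> : p = (p.1, p.2) by case: (p).
  rewrite /f /sqcell; congr pair.
    apply/setP=> v; rewrite in_setU in_setD; by case: (boolP (v \in P)) => // /(subsetP PF)->.
  apply/ffunP=> y; apply/val_inj; rewrite ffunE /= inordK ?ltnS ?(leq_trans (leq_b1 _)) //.
  by have := sq y; rewrite -suppE /multideg; case: (p.2 y : nat) => [|[|]].
case: leqP => [le|lt]; last first.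
  by apply/eqP; rewrite cards_eq0; apply/eqP/setP=> p; rewrite in_set0; apply/negP=> /Sf[]; rewrite leqNgt lt.
rewrite -cX -(cards_draws X) -(@card_in_imset _ _ f).
  apply: eq_card => p; apply/idP/imsetP => [pS|[G]].
    have [_ sX cG ->] := Sf p pS; exists (p.1 :\: P) => //.
    by rewrite inE sX cG /=.
  rewrite inE => /andP[/subsetP GX /eqP cG] ->.
  have PG : [disjoint P & G].
    by apply/pred0P=> y /=; apply/andP=> -[/PX h /GX]; rewrite (negPf h).
  rewrite inE; apply/and3P; split; last by rewrite support_sqcell.
    apply: kbasis_sqcell => //; first exact: ltnW.
      by rewrite cardsU (disjoint_setI0 PG) cards0 subn0 cP cG subnKC.
    by move=> y z yU zU; have [? ? _] := sep yU zU.
  apply/starP; split=> [y|y|y z].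
  - rewrite multideg_sqcell // in_setU; case: (boolP (y \in U)) => [yU|_]; last exact: leq_b1.
    by rewrite (negPf (UP yU)); case: (boolP (y \in G)) => // /GX h; have := UX yU; rewrite h.
  - rewrite !sqcell_expo // lt0b => yU; rewrite in_setU imset_f //; split=> //.
    case: (boolP (turn 2 y \in U)) => // h; have [_ _] := sep yU h.
    by rewrite eqxx.
  - rewrite !sqcell_expo // !lt0b in_setU => yU /orP[/imsetP[w wU ->]|zG] yz.
      by left; rewrite turn_succK.
    have := GX z zG; rewrite in_setU in_setC inE -yz; have := U_copy yU; rewrite inE => -> /=.
    by case/imsetP=> w wU ->; right; rewrite turn_predK.
move=> G G'; rewrite !inE => /andP[/subsetP GX _] /andP[/subsetP GX' _] /(congr1 fst) /= e.
apply/setP=> y; move/setP: e => /(_ y); rewrite !in_setU.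
have [yP _|//] := boolP (y \in P).
by rewrite (contraNF (GX y) (PX yP)) (contraNF (GX' y) (PX yP)).
Qed.

End Fibre.

Lemma card_star d i : i < d ->
  #|[set p : cell d | kb d i p & star p]| =
  #|[set U | separated U & #|U| == d - i]| *
  if d - i <= i then 'C((l - 1) * m + (d - i), i - (d - i)) else 0.
Proof.
move=> id; rewrite -sum1_card (partition_big (@support l m d) (fun U => separated U && (#|U| == d - i))).
  rewrite -sum_nat_const [RHS](eq_bigl (fun U => separated U && (#|U| == d - i))); last first.
    by move=> U; rewrite inE.
  apply: eq_bigr => U /andP[sU /eqP cU].
  have [x xU] : exists x, x \in U by apply/card_gt0P; rewrite cU; nlia.
  rewrite -(card_star_fibre sU xU id cU) -sum1_card; apply: eq_bigl => p.
  by rewrite !inE andbA.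
move=> p; rewrite inE => /andP[kp sp]; rewrite (star_separated kp sp).
by have /and3P[sq _ _] := sp; rewrite (card_support kp sq) eqxx.
Qed.

End Count.

(** * Counting spaced subsets of a cycle *)

Section Bits.
Implicit Types (s w : bitseq) (c n r i : nat).

Fixpoint bitseqs n : seq bitseq :=
  if n is n'.+1 then [seq true :: s | s <- bitseqs n'] ++ [seq false :: s | s <- bitseqs n']
  else [:: [::]].

Lemma mem_bitseqs n s : (s \in bitseqs n) = (size s == n).
Proof.
elim: n s => [|n IH] [|b s] //=; rewrite mem_cat.
  by apply/orP=> -[] /mapP[].
rewrite eqSS -IH; case: b.
  rewrite (mem_map (f := cons true)) ?orbF //; last by move=> ? ? [].
  by rewrite orbC; case: mapP => // -[].
rewrite [X in _ || X](mem_map (f := cons false)); last by move=> ? ? [].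
by case: mapP => // -[].
Qed.

Lemma count_bitseqsS (P : pred bitseq) n : count P (bitseqs n.+1) =
  count (fun s => P (true :: s)) (bitseqs n) + count (fun s => P (false :: s)) (bitseqs n).
Proof. by rewrite /= count_cat !count_map. Qed.

Lemma bitseqs_uniq n : uniq (bitseqs n).
Proof.
elim: n => //= n IH; rewrite cat_uniq !map_inj_uniq ?IH ?andbT /=; try by move=> ? ? [].
by apply/hasPn=> s /mapP[s' _ ->]; apply/mapP=> -[].
Qed.

Definition bits n (A : {set 'I_n}) : bitseq := [seq x \in A | x <- enum 'I_n].

Lemma size_bits n (A : {set 'I_n}) : size (bits A) = n.
Proof. by rewrite size_map size_enum_ord. Qed.

Lemma nth_bits n (A : {set 'I_n}) (i : 'I_n) : nth false (bits A) i = (i \in A).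
Proof. by rewrite (nth_map i) ?size_enum_ord // nth_ord_enum. Qed.

Lemma count_bits n (A : {set 'I_n}) : count id (bits A) = #|A|.
Proof. by rewrite count_map -sum1_count big_enum_cond -sum1_card; apply: eq_bigl. Qed.

Lemma card_set_bits n (P : pred bitseq) :
  #|[set A : {set 'I_n} | P (bits A)]| = count P (bitseqs n).
Proof.
have bits_inj : injective (@bits n).
  by move=> A B e; apply/setP=> i; rewrite -!nth_bits e.
rewrite cardE -(size_map (@bits n)) -size_filter; apply: perm_size; apply: uniq_perm.
- by rewrite map_inj_uniq ?enum_uniq.
- by rewrite filter_uniq ?bitseqs_uniq.
move=> s; rewrite mem_filter mem_bitseqs; apply/mapP/andP => [[A]|[Ps /eqP sn]].
  by rewrite mem_enum inE => PA ->; rewrite PA size_bits.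
have e : bits [set i : 'I_n | nth false s i] = s.
  apply: (@eq_from_nth _ false); rewrite size_bits // => i lt.
  by rewrite (nth_bits _ (Ordinal lt)) inE.
by exists [set i : 'I_n | nth false s i]; rewrite ?e // mem_enum inE e.
Qed.

(* Consecutive ones are at distance at least 3, and the first one is at position at least [c]. *)
Fixpoint spaced c s :=
  if s is b :: s' then (if b then (c == 0) && spaced 2 s' else spaced c.-1 s') else true.

Lemma spacedP c s : reflect
  ((forall i, i < c -> ~~ nth false s i) /\
   (forall i, nth false s i -> ~~ nth false s i.+1 && ~~ nth false s i.+2))
  (spaced c s).
Proof.
elim: s c => [|b s IH] c /=.
  by apply: ReflectT; split=> i; rewrite nth_nil.
case: b => /=.
  apply: (iffP andP) => [[/eqP-> /IH[h1 h2]]|[h1 h2]].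
    by split=> // -[_|i]; [rewrite /= !h1|exact: h2].
  split; first by case: c h1 => // c /(_ 0 isT).
  apply/IH; split=> [i|i]; last exact: (h2 i.+1).
  by have /andP[a b] := h2 0 isT; case: i => [|[|]].
apply: (iffP (IH _)) => -[h1 h2]; split.
- by move=> [|i] // ic; apply: h1; case: c ic.
- by move=> [|i] // /h2.
- by move=> i ic; apply: (h1 i.+1); case: c ic {h1}.
- by move=> i; exact: (h2 i.+1).
Qed.

(** The fixed suffix [w] stands for the initial bits repeated at the end of a cyclic word; its ones
    are not counted in [r]. *)
Definition nspaced w n c r := count (fun s => spaced c (s ++ w) && (count id s == r)) (bitseqs n).

Lemma nspaced0 w c r : nspaced w 0 c r = spaced c w && (r == 0).
Proof. by rewrite /nspaced /= addn0 eq_sym. Qed.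

Lemma nspacedS w n c r : nspaced w n.+1 c r =
  (if (c == 0) && (0 < r) then nspaced w n 2 r.-1 else 0) + nspaced w n c.-1 r.
Proof.
rewrite /nspaced /= count_cat !count_map; congr (_ + _).
case: c => [|c] /=; last by rewrite (eq_count (a2 := pred0)) ?count_pred0.
case: r => [|r] /=; last by apply: eq_count => s /=; rewrite add1n eqSS.
by rewrite (eq_count (a2 := pred0)) ?count_pred0 // => s /=; rewrite add1n andbF.
Qed.

(** The recursion on [n] never looks at the suffix, so comparing the values at length 0 is enough;
    [c] stays at most 2 throughout. *)
Lemma nspaced_suffix w a n c r : c <= 2 ->
  (forall c r, c <= 2 -> nspaced w 0 c r = nspaced [:: true] a c r) ->
  nspaced w n c r = nspaced [:: true] (n + a) c r.
Proof.
move=> c2 h; elim: n c r c2 => [|n IH] c r c2; first by rewrite h.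
rewrite addSn !nspacedS !IH //; last by case: c c2 => // c /ltnW.
Qed.

(** In front of a final one, every one is followed by two zeros: the words are arrangements of [r]
    blocks 100 and [n - 3 * r] single zeros. The induction is Pascal's rule. *)
Lemma nspacedE n r : nspaced [:: true] n 0 r = 'C(n - 2 * r, r).
Proof.
elim/ltn_ind: n r => -[|n] IH r.
  by rewrite nspaced0 /= bin0n.
rewrite nspacedS /= IH //; case: r => [|r] /=; first by rewrite !bin0.
case: n IH => [|[|n]] IH; rewrite ?nspacedS ?nspaced0 /=.
- by rewrite !bin_small //; nlia.
- by rewrite !bin_small //; nlia.
rewrite !add0n (IH n); last by nlia.
have [le|lt] := leqP (2 * r) n.
  have -> : n.+3 - 2 * r.+1 = (n - 2 * r).+1 by nlia.
  have -> : n.+2 - 2 * r.+1 = n - 2 * r by nlia.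
  by rewrite binS addnC.
by rewrite !bin_small //; nlia.
Qed.

(** Fix the first two bits: 11 is impossible, 10 and 01 each reduce to the linear count of length
    [n] with [r] ones, and 00 to that of length [n.+3] with [r.+1] ones. *)
Lemma count_cyclic n r : count (fun s => spaced 0 (s ++ take 2 s) && (count id s == r.+1)) (bitseqs n.+3) =
  'C(n.+3 - 2 * r.+1, r.+1) + 2 * 'C(n - 2 * r, r).
Proof.
rewrite count_bitseqsS !(@count_bitseqsS _ n.+1).
transitivity (0 + nspaced [:: true; false] n.+1 1 r + (nspaced [:: false; true] n.+1 2 r +
   nspaced [:: false; false] n.+1 0 r.+1)).
  congr (_ + _ + (_ + _)).
  - by rewrite (eq_count (a2 := pred0)) ?count_pred0.
  - by apply: eq_count => s /=; rewrite take0.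
  - by apply: eq_count => s /=; rewrite take0.
  - by apply: eq_count => s /=; rewrite take0.
rewrite (@nspaced_suffix _ 0) ?(@nspaced_suffix [:: false; true] 1) ?(@nspaced_suffix [:: false; false] 2) //.
- rewrite addn0 addn1 addn2 !nspacedE [nspaced _ n.+2 2 _]nspacedS /= add0n.
  by rewrite ![nspaced _ n.+1 _ _]nspacedS /= !add0n !nspacedE; nlia.
- by move=> [|[|[|c]]] r' // _; rewrite ?nspacedS !nspaced0 //=; case: r'.
- by move=> [|[|[|c]]] r' // _; rewrite ?nspacedS !nspaced0 //=; case: r'.
Qed.

End Bits.

(** * Separated sets of the join, reduced to separated sets of one cycle *)

Section CountSeparated.
Context {l m : nat} (m1 : 1 < m).
Local Notation V := 'I_(l * m).
Implicit Types (x y v g : V) (s t r : nat) (k : 'I_l) (A : {set 'I_m}) (U : {set V}).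

Definition cyc_separated A :=
  [forall i in A, forall j in A, ((i + 1) %% m != j) && ((i + 2) %% m != j)].

Lemma cyc_separatedE A : cyc_separated A = spaced 0 (bits A ++ take 2 (bits A)).
Proof.
set w := bits A ++ take 2 (bits A).
have sw : size w = m + 2 by rewrite size_cat size_takel size_bits.
have wE i : i < m + 2 -> nth false w i = nth false (bits A) (i %% m).
  move=> im; rewrite nth_cat size_bits; case: ltnP => h; first by rewrite modn_small.
  have im2 : i - m < 2 by nlia.
  rewrite nth_take //; congr nth; rewrite -{2}(subnK h) modnDr modn_small //.
  exact: leq_trans im2 m1.
have wA i : i < m + 2 -> nth false w i -> exists2 j : 'I_m, j \in A & (j : nat) = i %% m.
  move=> im; rewrite wE //; have lt : i %% m < m by rewrite ltn_pmod // ltnW.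
  by rewrite (nth_bits A (Ordinal lt)) => jA; exists (Ordinal lt).
have big i : m + 2 <= i -> nth false w i = false by move=> im; rewrite nth_default ?sw.
apply/idP/spacedP => [/forall_inP h|[_ h]].
  split=> // i wi; have im : i < m + 2 by rewrite ltnNge; apply/negP=> /big; rewrite wi.
  have [j jA ji] := wA i im wi; have {}h := forall_inP (h j jA).
  suff key e : 0 < e < 3 -> ~~ nth false w (i + e).
    by have := key 1 isT; have := key 2 isT; rewrite addn1 addn2 => -> ->.
  move=> e3; apply/negP=> we.
  have ie : i + e < m + 2 by rewrite ltnNge; apply/negP=> /big; rewrite we.
  have [j' j'A j'i] := wA _ ie we; have := h j' j'A.
  rewrite ji j'i !modnDml; have [->|->] : e = 1 \/ e = 2 by nlia.
    by rewrite eqxx.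
  by rewrite eqxx andbF.
apply/forall_inP=> i iA; apply/forall_inP=> j jA.
have wi : nth false w i by rewrite wE ?modn_small ?nth_bits // ltn_addr.
have wj e : (i + e) %% m == j -> e < 3 -> nth false w (i + e).
  by move=> /eqP ej e3; rewrite wE ?ej ?nth_bits //; have := ltn_ord i; nlia.
have /andP[h1 h2] := h i wi; apply/andP; split; apply/negP => /wj.
  by rewrite addn1 (negPf h1) => /(_ isT).
by rewrite addn2 (negPf h2) => /(_ isT).
Qed.

(** With [a = m - 2 * r] the count is ['C(a, r) + 2 * 'C(a - 1, r - 1)], and the absorption identity
    [a * 'C(a - 1, r - 1) = r * 'C(a, r)] yields the factor [a + 2 * r = m]. Multiplying by [a]
    avoids a division in [nat]. *)
Lemma card_cyc_separated r : 4 < m -> 0 < r -> 3 * r < m ->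
  (m - 2 * r) * #|[set A | cyc_separated A & #|A| == r]| = m * 'C(m - 2 * r, r).
Proof.
move=> m5; case: r => // r _ rm.
have -> : #|[set A | cyc_separated A & #|A| == r.+1]| =
    count (fun w => spaced 0 (w ++ take 2 w) && (count id w == r.+1)) (bitseqs m).
  rewrite -card_set_bits; apply: eq_card => A; rewrite !inE.
  by rewrite cyc_separatedE count_bits.
have [n mn] : exists n, m = n.+3 by exists (m - 3); nlia.
have a0 : 0 < m - 2 * r.+1 by nlia.
have := mul_bin_diag (m - 2 * r.+1) r.
have -> : (m - 2 * r.+1).-1 = n - 2 * r by nlia.
rewrite mn count_cyclic mulnDr => e; rewrite mulnCA e.
have -> : n.+3 * 'C(n.+3 - 2 * r.+1, r.+1) =
   (n.+3 - 2 * r.+1 + 2 * r.+1) * 'C(n.+3 - 2 * r.+1, r.+1) by congr (_ * _); nlia.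
by rewrite [in RHS]mulnDl mulnA.
Qed.

Lemma turn_mod s v : turn (s %% m) v = turn s v.
Proof.
rewrite {2}(divn_eq s m); elim: (s %/ m) => [|a IH]; first by rewrite mul0n add0n.
by rewrite mulSn -addnA addnC turn_addm.
Qed.

Definition base k : V := Ordinal (leq_trans (ltn_ord k) (leq_pmulr l (ltnW m1))).

Definition spread (q : 'I_l * {set 'I_m}) : {set V} := [set turn (s : 'I_m) (base q.1) | s in q.2].

Lemma mem_spread k A (s : 'I_m) : (turn s (base k) \in spread (k, A)) = (s \in A).
Proof.
apply/imsetP/idP => [[t tA /turn_inj e]|sA]; last by exists s.
by rewrite (_ : s = t) //; apply/val_inj/e.
Qed.

Lemma spread_copy k A x : x \in spread (k, A) -> x %% l = k.
Proof. by case/imsetP=> s _ ->; rewrite turn_copy /= modn_small. Qed.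

(** A nonempty separated set determines its copy; the empty set would be counted once for each copy,
    hence [0 < r]. *)
Lemma card_separated r : 0 < r -> #|[set U : {set V} | separated U & #|U| == r]| =
  l * #|[set A | cyc_separated A & #|A| == r]|.
Proof.
move=> r0.
have m0 : 0 < m := ltnW m1.
have spread_sep k A : separated (spread (k, A)) = cyc_separated A.
  have st (i j : 'I_m) e : (turn (i + e) (base k) == turn j (base k)) = ((i + e) %% m == j).
    apply/eqP/eqP => [|<-]; last by rewrite turn_mod.
    by rewrite -turn_mod; apply: turn_inj; rewrite // ltn_pmod.
  apply/separatedP/forall_inP => [h i iA|h x y /imsetP[i iA ->] /imsetP[j jA ->]].
    apply/forall_inP=> j jA.
    have := h (turn i (base k)) (turn j (base k)); rewrite !mem_spread => /(_ iA jA).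
    by rewrite !turn_add ![turn j _ == _]eq_sym !st => -[_ -> ->].
  have /forall_inP/(_ j jA)/andP[h1 h2] := h i iA.
  by rewrite !turn_copy !turn_add ![turn j _ == _]eq_sym !st.
have spread_card k A : #|spread (k, A)| = #|A|.
  by rewrite card_imset // => i j /turn_inj e; apply/val_inj/e.
have -> : l * #|[set A | cyc_separated A & #|A| == r]| =
    #|setX [set: 'I_l] [set A | cyc_separated A & #|A| == r]|.
  by rewrite cardsX cardsT card_ord.
rewrite -(@card_in_imset _ _ spread).
  apply: eq_card => U; apply/idP/imsetP => [|[[k A]]]; rewrite !inE; last first.
    by move=> /= h ->; rewrite spread_sep spread_card.
  case/andP=> sU /eqP cU.
  have [x xU] : exists x, x \in U by apply/card_gt0P; rewrite cU.
  have kl : x %% l < l by rewrite ltn_pmod // (gt0_l x).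
  pose k := Ordinal kl; pose A := [set s : 'I_m | turn s (base k) \in U].
  have UE : U = spread (k, A).
    have bx : base k %% l = x %% l by rewrite /= modn_mod.
    apply/setP=> y; apply/idP/imsetP => [yU|[s]]; last by rewrite inE => sU' ->.
    have yb : y %% l = base k %% l by rewrite bx; have /separatedP/(_ y x yU xU)[] := sU.
    exists (Ordinal (relpos_lt (base k) y)); last by rewrite /= relposK.
    by rewrite inE /= relposK.
  exists (k, A) => //; rewrite !inE /=.
  by rewrite -(spread_sep k) -(spread_card k) -UE sU cU eqxx.
move=> [k A] [k' A']; rewrite !inE /= => /andP[_ /eqP cA] _ e.
have [i iA] : exists i, i \in A by apply/card_gt0P; rewrite cA.
have kk : k = k'.
  apply/val_inj; rewrite /= -(spread_copy (k := k) (A := A) (x := turn i (base k))) ?mem_spread //.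
  by apply: (spread_copy (A := A')); rewrite -e mem_spread.
rewrite kk in e *; congr pair; apply/setP=> s.
by rewrite -(mem_spread k' A) -(mem_spread k' A') e.
Qed.

End CountSeparated.

Theorem theorem4p4 (K : fieldType) (m l : nat) (hm : (5 <= m)%N) (hl : (2 <= l)%N) :
  let E := circulant_adj (l * m) (join_S l m) in
  reg_eq K (l * m) E ((m + 1) %/ 3) /\
  (forall r i : nat, (2 <= r)%N -> (r < (m + 1) %/ 3)%N ->
     ((betti K (l * m) E i (i + r))%:R : rat) =
       ((l * m)%:R / (m - 2 * r)%:R) * ('C(m - 2 * r, r))%:R *
       (if (r <= i)%N then 'C((l - 1) * m + r, i - r) else 0%N)%:R)%R.
Proof.
move=> E; have m1 : 1 < m by exact: leq_trans hm.
have lm0 : 0 < l * m by rewrite muln_gt0 (ltnW hl) (ltnW m1).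
split; first split.
- exact: betti_top m1 (Ordinal lm0) hm.
- move=> i d; apply: contraR; rewrite -ltnNge => lt; apply/eqP; exact: betti_large.
(* The floor gives [3 * r + 3 <= m + 1], so [3 * r < m] and the denominator [m - 2 * r] is
   positive. *)
move=> r i r2 rK; have r3 : 3 * r < m by clear -rK; lia.
have a0 : 0 < m - 2 * r by clear -r3; lia.
have id : i.+1 < i + r by clear -r2; lia.
have id' : i < i + r := ltnW id.
rewrite betti_small // ?addKn // (card_star m1 id') addKn (card_separated m1) ?(ltnW r2) //.
have := card_cyc_separated m1 hm (ltnW r2) r3; set N := #|_| => cN.
rewrite !natrM; congr (_ * _)%R.
have a0' : ((m - 2 * r)%:R != 0 :> rat)%R by rewrite Num.Theory.pnatr_eq0 -lt0n.
have {}cN : ((m - 2 * r)%:R * N%:R = m%:R * 'C(m - 2 * r, r)%:R :> rat)%R by rewrite -!natrM cN.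
apply: (mulfI a0'); rewrite mulrCA cN [RHS]mulrA [X in (_ = X * _)%R]mulrCA divff // mulr1.
by rewrite mulrA.
Qed.
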